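(* Let $f$ be a real function that admits a Taylor expansion $f(x)=\sum_{j\ge0}a_jx^j$ near $0$ with $a_j\neq0$ for infinitely many even $j$, and define $F(X)=\sum_i f(\sigma_i(X))$ for square real matrices $X$. Then for every (arbitrarily large) positive integer $m$ there exists $c=c(m)>0$ such that any randomized streaming algorithm which outputs, with constant error probability, a $(1+c)$-approximation to $F(X)$ of an $N\times N$ matrix $X$ given as a stream of entry updates requires $\Omega(N^{1-1/m})$ bits of space.
   Context: $\sigma_i(X)$ are the singular values of $X$. Streaming model: the matrix $X$ (initially zero) receives updates $(i,j,\delta)$ meaning $X_{i,j}\leftarrow X_{i,j}+\delta$, and the algorithm outputs at the end. A $(1+c)$-approximation to $Q$ is a value within a factor $1\pm c$ of $Q$. *)

(* Defs.v *)
From HB Require Import structures.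
From mathcomp Require Export all_boot all_order all_algebra.
From mathcomp Require Export complex.
From mathcomp Require Export all_classical all_reals all_analysis.

Set Implicit Arguments.
Unset Strict Implicit.
Unset Printing Implicit Defensive.

Export Order.TTheory GRing.Theory Num.Theory.
Export numFieldNormedType.Exports.

Local Open Scope ring_scope.

(* The singular values of X : the square roots of the eigenvalues, with
   multiplicity, of X^T X.  The eigenvalues are taken from the spectral
   decomposition over R[i], where they are real and nonnegative (see the two
   lemmas below), so that taking their real part loses nothing.
   No particular ordering of the singular values is imposed. *)
Definition singular_value (R : realType) (n : nat) (X : 'M[R]_n) (i : 'I_n) : R :=
  Num.sqrt (complex.Re
    (spectral_diag (map_mx (real_complex R) (X^T *m X)) 0 i)).

Lemma char_poly_conj (C : fieldType) (n : nat) (P D : 'M[C]_n) :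
  P \in unitmx -> char_poly (invmx P *m D *m P) = char_poly D.
Proof.
move=> Pu; rewrite /char_poly.
have -> : char_poly_mx (invmx P *m D *m P) =
    map_mx polyC (invmx P) *m char_poly_mx D *m map_mx polyC P.
  rewrite /char_poly_mx !map_mxM mulmxBr mulmxBl; congr (_ - _).
  by rewrite -mulmxA -scalar_mxC mulmxA -map_mxM mulVmx // map_mx1 mul1mx.
rewrite !det_mulmx mulrAC -det_mulmx -map_mxM mulVmx //.
by rewrite map_mx1 det1 mul1r.
Qed.

Lemma gram_normalmx (R : realType) (n : nat) (X : 'M[R]_n) :
  map_mx (real_complex R) (X^T *m X) \is normalmx.
Proof.
apply: symmetric_normalmx.
  apply/is_hermitianmxP; rewrite expr0 scale1r map_mx_id //.
  by rewrite map_trmx trmx_mul trmxK.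
by apply/mxOverP => k l; rewrite mxE; apply/complex_realP; eexists.
Qed.

Lemma spectral_diag_gram_ge0 (R : realType) (n : nat) (X : 'M[R]_n) (i : 'I_n) :
  0 <= spectral_diag (map_mx (real_complex R) (X^T *m X)) 0 i.
Proof.
set A := map_mx _ _; set CX := map_mx (real_complex R) X.
have CXE : A = (CX ^t* )%sesqui *m CX.
  rewrite /A map_mxM; congr (_ *m _); apply/matrixP => k l; rewrite !mxE.
  by apply/esym; exact: conjc_real.
have /orthomx_spectralP AE := gram_normalmx X; rewrite -/A in AE.
have Pu : spectralmx A \is unitarymx by exact: spectral_unitarymx.
have DE : diag_mx (spectral_diag A) =
    ((CX *m (spectralmx A ^t* )%sesqui) ^t* )%sesqui
    *m (CX *m (spectralmx A ^t* )%sesqui).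
  rewrite trmx_mul map_mxM trmxCK !mulmxA -(mulmxA (spectralmx A)) -CXE.
  rewrite {3}AE !mulmxA mulmxV ?unitarymx_unit // mul1mx.
  by rewrite -mulmxA (unitarymxP Pu) mulmx1.
have := congr1 (fun M => fun_of_matrix M i i) DE; rewrite !mxE eqxx mulr1n => ->.
by apply: sumr_ge0 => k _; rewrite !mxE mulrC mul_conjC_ge0.
Qed.

Lemma char_poly_singular_value (R : realType) (n : nat) (X : 'M[R]_n) :
  char_poly (X^T *m X) = \prod_i ('X - (singular_value X i ^+ 2)%:P).
Proof.
apply: (map_poly_inj (real_complex R)).
rewrite map_char_poly.
have /orthomx_spectralP -> := gram_normalmx X.
rewrite char_poly_conj ?spectral_unit // char_poly_trig ?diag_mx_is_trig //.
rewrite rmorph_prod; apply: eq_bigr => i _.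
rewrite rmorphB /= map_polyX map_polyC /=; congr ('X - _%:P).
have ge0 := spectral_diag_gram_ge0 X i.
rewrite mxE eqxx mulr1n /singular_value sqr_sqrtr ?RRe_real ?ger0_real //.
by move: ge0; rewrite lecE => /andP[].
Qed.

Definition spectral_sum (R : realType) (f : R -> R) (n : nat) (X : 'M[R]_n) : R :=
  \sum_i f (singular_value X i).

Definition update (R : realType) (N : nat) : Type := ('I_N * 'I_N * R)%type.

Definition apply_update (R : realType) (N : nat) (X : 'M[R]_N)
    (u : update R N) : 'M[R]_N :=
  let: (i, j, delta) := u in X + delta *: delta_mx i j.

Definition stream_matrix (R : realType) (N : nat) (s : seq (update R N)) :
    'M[R]_N :=
  foldl (@apply_update R N) 0 s.

(* A randomized streaming algorithm for N x N matrices with S bits of memory.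
   A point of Omega is the outcome of all the random bits of the algorithm.
   Only the content of the memory survives from one update to the next.  The
   random bits may be read at any time and the number of updates already
   processed is known, both free of charge; this covers private coins (fresh
   randomness at every step) as well as public ones.  Steps are arbitrary
   functions: no computability is required. *)
Record stream_alg (R : realType) (Omega : Type) (N S : nat) := StreamAlg {
  sa_init : Omega -> S.-tuple bool;
  sa_step : Omega -> nat -> S.-tuple bool -> update R N -> S.-tuple bool;
  sa_output : Omega -> S.-tuple bool -> R
}.

Fixpoint sa_run (R : realType) (Omega : Type) (N S : nat)
    (A : stream_alg R Omega N S) (w : Omega) (t : nat) (q : S.-tuple bool)
    (s : seq (update R N)) : S.-tuple bool :=
  if s is u :: s' then sa_run A w t.+1 (sa_step A w t q u) s' else q.

Definition sa_result (R : realType) (Omega : Type) (N S : nat)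
    (A : stream_alg R Omega N S) (w : Omega) (s : seq (update R N)) : R :=
  sa_output A w (sa_run A w 0 (sa_init A w) s).

(* v is within a factor 1 +/- c of Q; the right-hand absolute value only
   matters for negative Q. *)
Definition approximation (R : realType) (c Q v : R) : Prop :=
  `|v - Q| <= c * `|Q|.

(* x is a rational whose numerator and denominator are at most N ^ k in
   absolute value, i.e. have O(log N) bits. *)
Definition log_bits (R : realType) (k N : nat) (x : R) : Prop :=
  exists p : int, exists q : nat,
    [/\ (`|p| <= N ^ k)%N, (0 < q <= N ^ k)%N & x = p%:~R / q%:R].

(* At all times, every entry of the matrix is an O(log N)-bit number. *)
Definition log_bits_stream (R : realType) (k N : nat) (s : seq (update R N)) :
    Prop :=
  forall (t : nat) (i j : 'I_N), log_bits k N (stream_matrix (take t s) i j).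

(* With probability at least 1 - eps the output of A is a
   (1 + c)-approximation to F(X), for every stream of O(log N)-bit entries.
   Nothing is asked on other streams: an algorithm that is correct on all
   streams of real updates satisfies this too, but a finite memory cannot in
   general tell apart the infinitely many scales of F(X) for unrestricted real
   X, so that demanding correctness there would make lower bounds on S hold for
   a reason unrelated to N. *)
Definition approximates_spectral_sum (R : realType) (f : R -> R) (k : nat)
    (c eps : R) (d : measure_display) (Omega : measurableType d)
    (P : probability Omega R) (N S : nat) (A : stream_alg R Omega N S) : Prop :=
  forall s : seq (update R N), log_bits_stream k s ->
    let good := [set w | approximation c (spectral_sum f (stream_matrix s))
                           (sa_result A w s)]%classic in
    measurable good /\ ((1 - eps)%:E <= P good)%E.

(* Main.v *)
Require Import Defs.
From mathcomp Require Import fingroup perm measurable_realfun.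
From mathcomp Require Import ring lra zify.

(* One-way communication.  Alice holds a sign vector x, put on the diagonal of
   the matrix; Bob holds random disjoint t-sets of positions and a bit w_e per
   set e, and joins each set into a cycle whose closing entry has sign w_e.
   Conjugating by diagonal sign matrices shows that the singular values of a
   block depend only on the product of its signs.  Hence, if w is the vector of
   parities of x on the sets, or its complement, F takes one of two values.
   They differ for small entries: the closed walks winding once around a cycle
   make the power sums of order 2t of the singular values differ, so that if
   a_(2t) <> 0 the two power series in the scale are distinct.

   The memory content after Alice's entries is a message of S bits.  Go from w
   to its complement one bit at a time.  Each step changes the success
   probability by the correlation between the character of x on one t-set and a
   function of the message and of x elsewhere.  Moving this t-set to random
   unused positions, a second moment computation and a Chernoff bound make the
   correlation roughly (S / N)^(t / 4); for S < N^(1 - 1/m) and t >= 8 (m + 1)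
   the total change over all steps tends to 0. *)

Set Implicit Arguments.
Unset Strict Implicit.
Unset Printing Implicit Defensive.

Local Open Scope classical_set_scope.
Local Open Scope ring_scope.

(** * Spectral sums of block matrices *)

(** A split monic polynomial determines its multiset of roots, so the [b i ^+ 2] are the squared
    singular values up to order; square roots recover the [b i] because they are nonnegative. *)
Lemma spectral_sum_char_poly (R : realType) (f : R -> R) n (X : 'M[R]_n)
    (b : 'I_n -> R) :
    (forall i, 0 <= b i) ->
    char_poly (X^T *m X) = \prod_i ('X - (b i ^+ 2)%:P) ->
  spectral_sum f X = \sum_i f (b i).
Proof.
move=> b_ge0; rewrite char_poly_singular_value => E.
have /prod_XsubC_eq E2 :
    \prod_(z <- [seq singular_value X i ^+ 2 | i <- index_enum 'I_n])
      ('X - z%:P) =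
    \prod_(z <- [seq b i ^+ 2 | i <- index_enum 'I_n]) ('X - z%:P).
  by rewrite !big_map.
have sgv_ge0 i : 0 <= singular_value X i by rewrite sqrtr_ge0.
have E3 : \sum_(z <- [seq singular_value X i ^+ 2 | i <- index_enum 'I_n])
    f (Num.sqrt z) =
    \sum_(z <- [seq b i ^+ 2 | i <- index_enum 'I_n]) f (Num.sqrt z).
  exact: perm_big.
rewrite !big_map in E3.
rewrite /spectral_sum.
rewrite (eq_bigr (fun i => f (Num.sqrt (singular_value X i ^+ 2)))); last first.
  by move=> i _; rewrite sqrtr_sqr ger0_norm.
by rewrite E3; apply: eq_bigr => i _; rewrite sqrtr_sqr ger0_norm.
Qed.

Lemma eq_spectral_sum (R : realType) (f : R -> R) n (X Y : 'M[R]_n) :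
  char_poly (X^T *m X) = char_poly (Y^T *m Y) ->
  spectral_sum f X = spectral_sum f Y.
Proof.
move=> E; apply: spectral_sum_char_poly; first by move=> i; rewrite sqrtr_ge0.
by rewrite E char_poly_singular_value.
Qed.

(** The Gram matrix [X^T *m X] is only replaced by its conjugate by [V]. *)
Lemma spectral_sum_orthogonal (R : realType) (f : R -> R) n (U X V : 'M[R]_n) :
  U^T *m U = 1%:M -> V^T *m V = 1%:M ->
  spectral_sum f (U *m X *m V) = spectral_sum f X.
Proof.
move=> UU VV; apply: eq_spectral_sum.
have [_ Vu] := mulmx1_unit VV.
have VT : V^T = invmx V by rewrite -[LHS](mulmxK Vu) VV mul1mx.
have -> : (U *m X *m V)^T *m (U *m X *m V) = invmx V *m (X^T *m X) *m V.
  by rewrite !trmx_mul VT !mulmxA -[_ *m U^T *m U]mulmxA UU mulmx1.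
exact: char_poly_conj.
Qed.

Lemma char_poly_block_diag (F : comNzRingType) n1 n2 (A : 'M[F]_n1) (B : 'M[F]_n2) :
  char_poly (block_mx A 0 0 B) = char_poly A * char_poly B.
Proof.
rewrite /char_poly /char_poly_mx map_block_mx !map_mx0 scalar_mx_block.
by rewrite opp_block_mx add_block_mx !oppr0 !addr0 det_ublock.
Qed.

Lemma spectral_sum_block_diag (R : realType) (f : R -> R) n1 n2
    (A : 'M[R]_n1) (B : 'M[R]_n2) :
  spectral_sum f (block_mx A 0 0 B) = spectral_sum f A + spectral_sum f B.
Proof.
pose b i := match fintype.split i with
  | inl i => singular_value A i | inr i => singular_value B i end.
have bl i : b (lshift n2 i) = singular_value A i by rewrite /b (unsplitK (inl i)).
have br i : b (rshift n1 i) = singular_value B i by rewrite /b (unsplitK (inr i)).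
rewrite (@spectral_sum_char_poly _ _ _ _ b).
- rewrite big_split_ord /=; congr (_ + _); apply: eq_bigr => i _;
  by rewrite ?bl ?br.
- by move=> i; rewrite /b; case: fintype.split => j; rewrite sqrtr_ge0.
rewrite tr_block_mx !trmx0 mulmx_block !mul0mx !mulmx0 !addr0 !add0r.
rewrite char_poly_block_diag !char_poly_singular_value big_split_ord /=.
by congr (_ * _); apply: eq_bigr => i _; rewrite ?bl ?br.
Qed.

(** Substituting [c *: 'X] pulls a factor [c] out of each row: det(cX - cA) = c^n det(X - A).
    Composing with [c^-1 *: 'X] undoes the substitution. *)
Lemma char_polyZ (F : fieldType) n (c : F) (A : 'M[F]_n) (s : 'I_n -> F) :
  c != 0 -> char_poly A = \prod_i ('X - (s i)%:P) ->
  char_poly (c *: A) = \prod_i ('X - (c * s i)%:P).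
Proof.
move=> c0 E.
have Hc : char_poly (c *: A) \Po (c *: 'X) = c ^+ n *: char_poly A.
  rewrite /char_poly -[LHS](det_map_mx (comp_poly (c *: 'X))).
  rewrite -[RHS]mul_polyC rmorphXn /= -detZ; congr (\det _).
  apply/matrixP => i j; rewrite !mxE comp_polyB comp_polyC -mulr_natr.
  rewrite comp_polyM comp_polyX -polyC_natr comp_polyC polyCM mulrBr polyC_natr.
  by rewrite mul_polyC -mulr_natr -?scalerAl ?mul_polyC.
have cc : (c *: 'X : {poly F}) \Po (c^-1 *: 'X) = 'X.
  by rewrite comp_polyZ comp_polyX scalerA mulfV // scale1r.
rewrite -[LHS]comp_polyXr -[X in _ \Po X]cc comp_polyA Hc E comp_polyZ rmorph_prod /=.
have -> : c ^+ n = \prod_(i < n) c by rewrite prodr_const card_ord.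
rewrite -scaler_prod; apply: eq_bigr => i _.
rewrite comp_polyB comp_polyX comp_polyC scalerBr scalerA mulfV // scale1r.
by rewrite polyCM mul_polyC.
Qed.

Lemma spectral_sumZ (R : realType) (f : R -> R) n (c : R) (X : 'M[R]_n) :
  0 < c -> spectral_sum f (c *: X) = \sum_i f (c * singular_value X i).
Proof.
move=> c0; apply: spectral_sum_char_poly => [i|].
  by rewrite mulr_ge0 ?sqrtr_ge0 // ltW.
rewrite [(c *: X)^T]linearZ -scalemxAl -scalemxAr scalerA -expr2.
under eq_bigr do rewrite exprMn.
by apply: char_polyZ (char_poly_singular_value X); rewrite expf_neq0 ?gt_eqF.
Qed.

Lemma conj_diag_mx_exp (F : fieldType) n (P : 'M[F]_n.+1) (d : 'rV[F]_n.+1) k :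
  P \in unitmx ->
  (invmx P *m diag_mx d *m P) ^+ k = invmx P *m diag_mx (\row_i d 0 i ^+ k) *m P.
Proof.
move=> Pu; elim: k => [|k IHk].
  rewrite expr0; have -> : diag_mx (\row_i d 0 i ^+ 0) = 1%:M.
    by apply/matrixP => i j; rewrite !mxE expr0.
  by rewrite mulmx1 mulVmx.
rewrite exprS IHk -[_ * _]/(_ *m _) !mulmxA mulmxK // -(mulmxA (invmx P)).
rewrite mulmx_diag.
suff -> : \row_i (d 0 i * (\row_j d 0 j ^+ k) 0 i) = \row_i d 0 i ^+ k.+1 by [].
by apply/rowP => i; rewrite !mxE exprS.
Qed.

Lemma mxtrace_gram_exp (R : realType) n (X : 'M[R]_n.+1) k :
  \tr ((X^T *m X) ^+ k) = \sum_i singular_value X i ^+ (2 * k).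
Proof.
set A := X^T *m X.
have /orthomx_spectralP AE := gram_normalmx X; rewrite -/A in AE.
set P := spectralmx _ in AE; set d := spectral_diag _ in AE.
have Pu : P \in unitmx by exact: spectral_unit.
apply: (@complexI R).
have trM B : real_complex R (\tr B) = \tr (map_mx (real_complex R) B) :> R[i].
  by rewrite /mxtrace rmorph_sum; apply: eq_bigr => i _; rewrite mxE.
rewrite trM rmorphXn /= AE.
rewrite conj_diag_mx_exp //.
rewrite -mulmxA mxtrace_mulC mulmxK // mxtrace_diag rmorph_sum.
apply: eq_bigr => i _; rewrite mxE rmorphXn exprM; congr (_ ^+ _).
rewrite /singular_value -/A -/d -rmorphXn.
have := spectral_diag_gram_ge0 X i; rewrite -/A -/d => d0.
rewrite sqr_sqrtr; first by rewrite [RHS]RRe_real // ger0_real.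
by move: d0; rewrite lecE => /andP[].
Qed.

(** * Signed cycles *)

(** Weighted adjacency matrix of the directed cycle 0 -> 1 -> ... -> t -> 0; the closing arc has
    weight [s], the others weight 1. *)
Definition cyc_mx (R : pzRingType) (t : nat) (s : R) : 'M[R]_t.+1 :=
  \matrix_(i, j) ((j == i.+1 :> nat)%:R + s * ((i == t :> nat) && (j == 0))%:R).

Lemma mul_cyc_mx (R : pzRingType) t (s : R) n (A : 'M[R]_(t.+1, n)) i j :
  (cyc_mx t s *m A) i j =
  if (i < t)%N then A (inord i.+1) j else s * A 0 j.
Proof.
rewrite mxE; case: ltnP => it.
  rewrite (bigD1 (inord i.+1)) //= mxE inordK ?ltnS // eqxx ltn_eqF //.
  rewrite mulr0 addr0 mul1r big1 ?addr0 // => k ki; rewrite mxE (ltn_eqF it).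
  rewrite mulr0 addr0; case: eqP => [ki'|]; last by rewrite mul0r.
  by case/eqP: ki; apply: val_inj; rewrite /= inordK ?ltnS.
have ti : i = t :> nat by apply/eqP; rewrite eqn_leq it -ltnS ltn_ord.
rewrite (bigD1 0) //= mxE ti eqxx /= mulr1 add0r big1 ?addr0 // => k k0.
by rewrite mxE ti eqxx (negPf k0) mulr0 addr0 ltn_eqF ?mul0r.
Qed.

(** A walk of at most t + 1 steps crosses the closing arc at most once. The two terms are the walks
    that do not cross it and those that do. *)
Lemma cyc_mx_exp (R : pzRingType) t (s : R) k i j : (k <= t.+1)%N ->
  (cyc_mx t s ^+ k) i j =
  (nat_of_ord j == i + k)%N%:R + s * (j + t.+1 == i + k)%N%:R.
Proof.
elim: k i j => [|k IHk] i j kt.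
  rewrite expr0 mxE !addn0 [in X in _ + X](_ : (j + t.+1 == i)%N = false).
    by rewrite mulr0 addr0 eq_sym.
  by have := ltn_ord i; lia.
rewrite exprS -[_ * _]/(_ *m _) mul_cyc_mx !(IHk _ _ (ltnW kt)); case: ltnP => it.
  by rewrite inordK ?ltnS // !addSnnS.
have -> : i = t :> nat by apply/eqP; rewrite eqn_leq it -ltnS ltn_ord.
rewrite add0n; have -> : (j + t.+1 == k)%N = false by lia.
have -> : (nat_of_ord j == t + k.+1)%N = false by have := ltn_ord j; lia.
rewrite mulr0 addr0 add0r; congr (_ * (nat_of_bool _)%:R).
by rewrite addnS -addSn addnC eqn_add2l.
Qed.

Section CycTrace.
Variables (R : realType) (t : nat) (s : R).
Hypothesis s2 : s ^+ 2 = 1.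
Local Notation C := (cyc_mx t s).

Lemma cyc_mx_exp_size : C ^+ t.+1 = s%:M.
Proof.
apply/matrixP => i j; rewrite cyc_mx_exp // mxE eqn_add2r.
have -> : (nat_of_ord j == i + t.+1)%N = false by have := ltn_ord j; lia.
by rewrite add0r mulr_natr eq_sym.
Qed.

Lemma trmx_cyc_mx : C^T = s *: C ^+ t.
Proof.
apply/matrixP => i j; rewrite !mxE cyc_mx_exp // mulrDr mulrA -expr2 s2 mul1r.
rewrite addnS -addSn eqn_add2r addrC [i == j.+1 :> nat]eq_sym.
congr (_ * (nat_of_bool _)%:R + _).
by rewrite -[i == 0]/(nat_of_ord i == 0)%N; have := ltn_ord j; have := ltn_ord i; lia.
Qed.

Lemma mxtrace_cyc_mx_exp a b : (b <= t)%N ->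
  \tr (C ^+ (t.+1 * a + b)) = s ^+ a * (t.+1 * (b == 0))%:R.
Proof.
move=> bt; rewrite exprD exprM cyc_mx_exp_size.
have -> : (s%:M : 'M[R]_t.+1) ^+ a = (s ^+ a)%:M by rewrite -rmorphXn.
rewrite -[_ * _]/(_ *m _) mul_scalar_mx linearZ /=; congr (_ * _).
case: b bt => [|b] bt; first by rewrite expr0 mxtrace1 muln1.
rewrite muln0 /mxtrace big1 // => i _; rewrite cyc_mx_exp ?leqW //.
have -> : (nat_of_ord i == i + b.+1)%N = false by lia.
have -> : (i + t.+1 == i + b.+1)%N = false by lia.
by rewrite mulr0 addr0.
Qed.

(* With C = cyc_mx t s, the transpose of C is s C^t = C^-1, hence
   (1 + C)^T (1 + C) = s C^t (1 + C)^2, and among the powers of C only those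
   whose exponent is a multiple of t + 1 have a nonzero trace. *)
Lemma mxtrace_cyc_gram :
  \tr (((1%:M + C)^T *m (1%:M + C)) ^+ t.+1) =
  t.+1%:R * (('C(t.+1 + t.+1, t.+1))%:R + s *+ 2).
Proof.
have -> : (1%:M + C)^T *m (1%:M + C) = s *: (C ^+ t * (C + 1) ^+ 2).
  have -> : (1%:M + C)^T = 1 + C^T by apply/matrixP => i j; rewrite !mxE eq_sym.
  rewrite trmx_cyc_mx -[_ *m _]/(_ * _) -[1%:M]/1.
  have {1}-> : 1 = s *: (C ^+ t * C) :> 'M[R]_t.+1.
    by rewrite -exprSr cyc_mx_exp_size -mul_scalar_mx -scalar_mxM -expr2 s2.
  by rewrite -scalerDr -{2}[C ^+ t]mulr1 -mulrDr -scalerAl -mulrA expr2 [1 + C]addrC.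
rewrite exprZn exprMn_comm; last first.
  by apply: commrX; apply: commr_sym; apply: commrX; apply: commr_sym;
     apply: commrD; [exact: commr_refl|exact: commr1].
rewrite -!exprM mulnC exprM cyc_mx_exp_size.
have -> : (s%:M : 'M[R]_t.+1) ^+ t = (s ^+ t)%:M by rewrite -rmorphXn.
rewrite -[X in \tr (_ *: X)]/(_ *m _) mul_scalar_mx scalerA -exprD linearZ /=.
have -> : s ^+ (t.+1 + t) = s.
  by rewrite addSn exprS addnn -mul2n exprM s2 expr1n mulr1.
rewrite mul2n -addnn exprD1n raddf_sum /=.
under eq_bigr do rewrite raddfMn /=.
(* The exponents 0, ..., 2(t + 1) are cut into two runs of length t + 1 and the last exponent. In
   each run only the first exponent has a nonzero trace, so the surviving exponents are 0, t + 1 and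
   2(t + 1). *)
rewrite -addnS big_split_ord /= [X in _ + X]big_ord_recr /=.
rewrite [X in X + _]big_ord_recl big1; last first.
  move=> i _; have := @mxtrace_cyc_mx_exp 0 (lift ord0 i) (ltn_ord _).
  by rewrite muln0 add0n => ->; rewrite /= ?muln0 ?mulr0n ?mulr0 ?mul0rn.
rewrite [X in _ + (X + _)]big_ord_recl big1; last first.
  move=> i _; have := @mxtrace_cyc_mx_exp 1 (lift ord0 i) (ltn_ord _).
  by rewrite muln1 => ->; rewrite /= ?muln0 ?mulr0n ?mulr0 ?mul0rn.
have := @mxtrace_cyc_mx_exp 0 0 isT; have := @mxtrace_cyc_mx_exp 1 0 isT.
have := @mxtrace_cyc_mx_exp 2 0 isT.
rewrite !muln0 !muln1 !addn0 muln2 -addnn s2 expr0 expr1 !mul1r => -> /= -> ->.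
rewrite bin0 binn !mulr1n !addr0 -[_ *+ 'C(_, _)]mulr_natr.
by rewrite !mulrDr !mulrA -expr2 s2; ring.
Qed.

End CycTrace.

Definition cyc_spectrum (R : realType) t (s : R) (i : 'I_t.+1) : R :=
  singular_value (1%:M + cyc_mx t s) i.

(** In [mxtrace_cyc_gram] the binomial terms cancel, and the two sides differ by 4(t + 1). *)
Lemma cyc_spectrum_power_sum_neq (R : realType) t :
  \sum_i @cyc_spectrum R t 1 i ^+ (2 * t.+1) !=
  \sum_i @cyc_spectrum R t (-1) i ^+ (2 * t.+1).
Proof.
rewrite -!mxtrace_gram_exp !mxtrace_cyc_gram ?sqrrN ?expr1n //.
rewrite -subr_eq0 -mulrBr mulf_neq0 ?pnatr_eq0 //.
by rewrite opprD addrACA subrr add0r mulNrn opprK -mulrnDr pnatr_eq0.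
Qed.

Definition sgb (R : pzRingType) (b : bool) : R := (-1) ^+ b.
Arguments sgb R : clear implicits.

Lemma sgb2 (R : pzRingType) b : sgb R b * sgb R b = 1.
Proof. by case: b; rewrite /sgb /= ?mulr1 // mulrNN mulr1. Qed.

(* Conjugating by diagonal sign matrices moves all the signs of the cycle to
   its closing entry. *)
Lemma spectral_sum_signed_cycle (R : realType) (f : R -> R) t (c : R)
    (x : 'I_t.+1 -> bool) (w : bool) :
  spectral_sum f (c *: (diag_mx (\row_i sgb R (x i)) + cyc_mx t (sgb R w))) =
  spectral_sum f
    (c *: (1%:M + cyc_mx t (sgb R w * \prod_i sgb R (x i)))).
Proof.
(* The left factor has entries [b i.+1] and the right one [b i]. This shift turns the diagonal signs
   and the ordinary arcs into 1 and leaves [b t.+1 * b 0], the product of all signs, on the closing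
   arc. *)
pose b k := \prod_(i < t.+1 | (i < k)%N) sgb R (x i).
have b2 k : b k * b k = 1.
  by rewrite -big_split /= big1 // => i _; rewrite sgb2.
have bS (i : 'I_t.+1) : b i.+1 = sgb R (x i) * b i.
  rewrite /b (bigD1 i) //=; congr (_ * _); apply: eq_bigl => j.
  by rewrite ltnS (ltn_neqAle j) andbC.
have b0 : b 0 = 1 by rewrite /b big_pred0.
have bt : b t.+1 = \prod_i sgb R (x i).
  by rewrite /b; apply: eq_bigl => i; rewrite ltn_ord.
have orth (e : nat -> R) : (forall k, e k * e k = 1) ->
    (diag_mx (\row_(i < t.+1) e i))^T *m diag_mx (\row_i e i) = 1%:M.
  move=> e2; rewrite tr_diag_mx mulmx_diag; apply/matrixP => i j.
  by rewrite !mxE e2.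
rewrite -(spectral_sum_orthogonal f _ (orth (fun k => b k.+1) (fun k => b2 k.+1))
  (orth b b2)) -scalemxAr -scalemxAl; congr (spectral_sum _ (_ *: _)).
apply/matrixP => i j; rewrite mul_mx_diag mul_diag_mx !mxE.
rewrite mulrDr mulrDl; congr (_ + _).
  have [->|_] := eqVneq i j; last by rewrite !mulr0n mulr0 mul0r.
  by rewrite !mulr1n bS -mulrA mulrACA sgb2 b2 mulr1.
rewrite mulrDr mulrDl; congr (_ + _).
  have [->|_] := eqVneq (nat_of_ord j) i.+1; last by rewrite mulr0 mul0r.
  by rewrite mulr1 b2.
case: eqP => [->|_]; last by rewrite !mulr0 mul0r.
case: eqP => [->|_] /=; last by rewrite !mulr0 mul0r.
by rewrite !mulr1 b0 mulr1 bt mulrC.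
Qed.

(** * The hard instances *)

(** The recursion needs no cast since [l'.+1 * t] is convertible to [t + l' * t]. *)
Fixpoint block_diag (R : pzRingType) t l : ('I_l -> 'M[R]_t) -> 'M[R]_(l * t) :=
  match l return ('I_l -> 'M[R]_t) -> 'M[R]_(l * t) with
  | 0 => fun _ => 0
  | l'.+1 => fun B => block_mx (B ord0) 0 0
                        (block_diag (fun j => B (lift ord0 j)))
  end.

Lemma block_index_subproof l t (j : 'I_l) (g : 'I_t) : (j * t + g < l * t)%N.
Proof.
apply: (@leq_trans (j.+1 * t)); first by rewrite mulSn addnC ltn_add2r.
by rewrite leq_mul2r ltn_ord orbT.
Qed.

Definition block_index l t (j : 'I_l) (g : 'I_t) : 'I_(l * t) :=
  Ordinal (block_index_subproof j g).

Lemma block_index_inj l t (j j' : 'I_l) (g g' : 'I_t) :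
  block_index j g = block_index j' g' -> j = j' /\ g = g'.
Proof.
move=> /(congr1 val) /= E; have := ltn_ord g; have := ltn_ord g' => g't gt.
have t0 : (0 < t)%N by exact: leq_ltn_trans gt.
have /(congr1 (divn^~ t)) := E; rewrite !divnMDl // !divn_small // !addn0 => jj.
by split; apply: val_inj => //=; move/eqP: E; rewrite jj eqn_add2l => /eqP.
Qed.

(** The boolean argument of [P] tells whether the entry is diagonal, so that diagonal and
    off-diagonal claims are transferred together. *)
Lemma block_diag_entry (R : pzRingType) t (P : bool -> R -> Prop) l
    (B : 'I_l -> 'M[R]_t) k k' :
  (forall b, P b 0) -> (forall j g g', P (g == g') (B j g g')) ->
  P (k == k') (block_diag B k k').
Proof.
move=> P0; elim: l B k k' => [|l IHl] B k k' PB /=; first by rewrite mxE.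
rewrite -[k]splitK -[k']splitK; case: (fintype.split k) => {}k;
  case: (fintype.split k') => {}k' /=.
- by rewrite block_mxEul (inj_eq (@lshift_inj _ _)).
- by rewrite block_mxEur mxE.
- by rewrite block_mxEdl mxE.
- by rewrite block_mxEdr (inj_eq (@rshift_inj _ _)); apply: IHl.
Qed.

Lemma spectral_sum_signed_diag (R : realType) (f : R -> R) n (c : R)
    (x : 'I_n -> bool) :
  0 < c -> spectral_sum f (c *: diag_mx (\row_i sgb R (x i))) = n%:R * f c.
Proof.
move=> c0; rewrite (@spectral_sum_char_poly _ _ _ _ (fun=> c)).
- by rewrite sumr_const card_ord mulr_natl.
- by move=> _; exact: ltW.
rewrite [(c *: _)^T]linearZ -scalemxAl -scalemxAr scalerA -expr2 /= tr_diag_mx.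
rewrite mulmx_diag char_poly_trig; last first.
  by apply/is_trig_mxP => i j ij; rewrite !mxE -val_eqE ltn_eqF ?mulr0.
by apply: eq_bigr => i _; rewrite !mxE eqxx sgb2 mulr1.
Qed.

Lemma spectral_sum_block_diag_signs (R : realType) (f : R -> R) t l (c : R)
    (B : 'I_l -> 'M[R]_t) (v : 'I_(l * t) -> R) :
  spectral_sum f (c *: (diag_mx (\row_k v k) + block_diag B)) =
  \sum_j spectral_sum f (c *: (diag_mx (\row_g v (block_index j g)) + B j)).
Proof.
elim: l B v => [|l IHl] B v; first by rewrite big_ord0 [LHS]big_ord0.
rewrite big_ord_recl /=.
have -> : diag_mx (\row_k v k) + block_diag B =
  block_mx (diag_mx (\row_g v (block_index ord0 g)) + B ord0) 0 0
    (diag_mx (\row_k v (rshift t k)) + block_diag (fun j => B (lift ord0 j))).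
  have -> : \row_k v k = row_mx (\row_g v (block_index ord0 g))
      (\row_k v (rshift t k)) :> 'rV_(t + l * t).
    apply/rowP => k; rewrite -[k]splitK; case: (fintype.split k) => {}k /=.
      by rewrite row_mxEl !mxE; congr v; apply: val_inj.
    by rewrite row_mxEr !mxE.
  by rewrite diag_mx_row /= add_block_mx !addr0.
rewrite (@scale_block_mx _ t (l * t) t (l * t)) !scaler0.
rewrite (@spectral_sum_block_diag _ _ t (l * t)).
congr (_ + _).
rewrite (IHl (fun j => B (lift ord0 j)) (fun k => v (rshift t k))).
apply: eq_bigr => j _.
suff -> : \row_g v (rshift t (block_index j g)) =
    \row_g v (block_index (lift ord0 j) g) :> 'rV_t by [].
apply/rowP => g; rewrite !mxE; congr v; apply: val_inj.
by rewrite /= /bump /= add1n mulSn addnA.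
Qed.

Section HardInstance.
Variables (R : realType) (t l q : nat) (c : R).
Hypothesis c_gt0 : 0 < c.
Local Notation N := (l * t.+1 + q)%N.

Definition edge (j : 'I_l) (g : 'I_t.+1) : 'I_N := lshift q (block_index j g).

Definition parity (x : {ffun 'I_N -> bool}) (p : {perm 'I_N}) : {ffun 'I_l -> bool} :=
  [ffun j => \big[addb/false]_g x (p (edge j g))].

Definition cycles_mx (w : {ffun 'I_l -> bool}) : 'M[R]_N :=
  block_mx (block_diag (fun j => cyc_mx t (sgb R (w j)))) 0 0 0.

Definition alice_mx (x : {ffun 'I_N -> bool}) : 'M[R]_N :=
  c *: diag_mx (\row_i sgb R (x i)).

Definition bob_mx (p : {perm 'I_N}) (w : {ffun 'I_l -> bool}) : 'M[R]_N :=
  c *: \matrix_(i, j) cycles_mx w (p^-1%g i) (p^-1%g j).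

Lemma sgb_parity x p j : sgb R (parity x p j) = \prod_g sgb R (x (p (edge j g))).
Proof.
rewrite ffunE; apply: (big_morph (sgb R)) => //.
by case; case; rewrite /sgb /= ?expr0 ?expr1 ?mulr1 ?mul1r ?mulrNN ?mulr1.
Qed.

(** Undoing [p] by permutation matrices leaves one block per cycle and [q] diagonal entries. In
    block [j] the parity of [x] cancels against the closing sign, so every block has sign product
    [sgb R b]. *)
Lemma spectral_sum_hard_instance (f : R -> R) x p b :
  spectral_sum f (alice_mx x + bob_mx p [ffun j => parity x p j (+) b]) =
  l%:R * spectral_sum f (c *: (1%:M + cyc_mx t (sgb R b))) + q%:R * f c.
Proof.
set w := finfun _.
have -> : alice_mx x + bob_mx p w = perm_mx p^-1%g *m
    (c *: (diag_mx (\row_k sgb R (x (p k))) + cycles_mx w)) *m perm_mx p.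
  rewrite -row_permE -[X in perm_mx X]invgK -col_permE /alice_mx /bob_mx -scalerDr.
  apply/matrixP => i j; rewrite !mxE permKV; congr (_ * (_ *+ _ + _)).
  by rewrite (inj_eq perm_inj).
have perm_orth (s : {perm 'I_N}) : (perm_mx s)^T *m perm_mx s = 1%:M :> 'M[R]_N.
  by rewrite tr_perm_mx -perm_mxM mulVg perm_mx1.
rewrite spectral_sum_orthogonal //.
have -> : \row_k sgb R (x (p k)) = row_mx (\row_k sgb R (x (p (lshift q k))))
    (\row_k sgb R (x (p (rshift (l * t.+1) k)))) :> 'rV[R]_N.
  apply/rowP => k; rewrite -[k]splitK; case: (fintype.split k) => {}k /=.
    by rewrite row_mxEl !mxE.
  by rewrite row_mxEr !mxE.
rewrite diag_mx_row /cycles_mx add_block_mx !addr0 scale_block_mx !scaler0.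
rewrite spectral_sum_block_diag spectral_sum_signed_diag //; congr (_ + _).
rewrite spectral_sum_block_diag_signs.
rewrite (eq_bigr (fun=> spectral_sum f (c *: (1%:M + cyc_mx t (sgb R b))))).
  by rewrite sumr_const card_ord mulr_natl.
move=> j _; rewrite spectral_sum_signed_cycle -sgb_parity /w ffunE {w}.
congr (spectral_sum _ (_ *: (_ + cyc_mx _ _))).
by case: (parity x p j); case: b;
   rewrite /sgb /= ?expr0 ?expr1 ?mulr1 ?mul1r ?mulrNN ?mulr1.
Qed.

(** For t > 0 the cycles have no loops, so Bob never touches the diagonal, where all of Alice's
    entries are. *)
Lemma bob_mx_entry p w i j : (0 < t)%N ->
  if i == j then bob_mx p w i j = 0
  else bob_mx p w i j \in [:: 0; c; - c].
Proof.
move=> t0; pose P (b : bool) (z : R) :=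
  if b then c * z = 0 else c * z \in [:: 0; c; - c].
have P0 b : P b 0 by case: b; rewrite /P mulr0 ?mem_head.
have : P (p^-1%g i == p^-1%g j) (cycles_mx w (p^-1%g i) (p^-1%g j)).
  move: (p^-1%g i) (p^-1%g j) => k k'; rewrite /cycles_mx.
  rewrite -[k]splitK -[k']splitK; case: (fintype.split k) => {}k;
    case: (fintype.split k') => {}k' /=; rewrite ?block_mxEul ?block_mxEur
    ?block_mxEdl ?block_mxEdr ?(inj_eq (@lshift_inj _ _)) ?[const_mx _ _ _]mxE //.
  apply: (@block_diag_entry _ _ P) => // {k k'} j' g g'; rewrite mxE /P.
  have [->|gg'] := eqVneq g g'.
    rewrite ltn_eqF // add0r; have [->|] := eqVneq g' 0; last by rewrite andbF !mulr0.
    by rewrite /= eq_sym gtn_eqF //= !mulr0.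
  have [E|_] := eqVneq (nat_of_ord g') g.+1.
    have -> : (g' == 0) = false by apply/eqP => g0; rewrite g0 in E.
    by rewrite andbF mulr0 addr0 mulr1 !inE eqxx orbT.
  case: (_ && _); rewrite add0r ?mulr0 ?mem_head // mulr1 /sgb.
  by case: (w j'); rewrite /= ?expr0 ?expr1 ?mulr1 ?mulrN1 !inE eqxx ?orbT.
by rewrite (inj_eq perm_inj) /P !mxE; case: eqP.
Qed.

Lemma alice_mx_entry x i j :
  if i != j then alice_mx x i j = 0 else alice_mx x i j \in [:: c; - c].
Proof.
rewrite !mxE; case: eqVneq => _ /=; last by rewrite mulr0n mulr0.
rewrite mulr1n.
by case: (x i); rewrite /sgb /= ?expr0 ?expr1 ?mulr1 ?mulrN1 !inE eqxx ?orbT.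
Qed.

End HardInstance.

(** * Choice of the scale *)

(** At the first nonzero coefficient [b j], a small zero x makes |b_j x^j| equal to the modulus of
    the tail, which is at most 2K (x/r)^(j+1); this fails for x small enough. *)
Lemma pseries_eq0 (R : realType) (b : nat -> R) (r : R) :
    0 < r -> cvgn (pseries b r) ->
    (forall e, 0 < e -> exists x, [/\ 0 < x, x < e & pseries b x @ \oo --> 0]) ->
  forall j, b j = 0.
Proof.
move=> r0 /cvg_series_cvg_0 br0 bx.
have [K K0 Kb] : exists2 K, 0 < K & forall i, `|b i * r ^+ i| <= K.
  have : cvgn (fun i => b i * r ^+ i) by apply/cvg_ex; exists 0.
  move=> /cvg_seq_bounded; rewrite /bounded_near => /pinfty_ex_gt0[K K0 Kb].
  by exists K => // i; apply: Kb.
apply: ltn_ind => j IHj; apply/eqP; apply: contraT => bj0.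
have nbj : 0 < `|b j| by rewrite normr_gt0.
(* The first bound makes the ratio x/r at most 1/2, so the geometric tail sums to at most twice its
   first term; the second is exactly what contradicts the resulting estimate. *)
have [x [x0 xe bx0]] := bx (Num.min (r / 2) (`|b j| * r ^+ j.+1 / (2 * K)))
   ltac:(by rewrite lt_min !divr_gt0 ?mulr_gt0 ?exprn_gt0).
move: xe; rewrite lt_min => /andP[xr xb].
pose y := x / r.
have y0 : 0 < y by rewrite divr_gt0.
have y2 : 2 * y <= 1 by rewrite /y mulrA ler_pdivrMr // mul1r -ler_pdivlMl // mulrC ltW.
(* The bound [2 - 2 * y ^+ n] absorbs each new term [y ^+ n] because 2y <= 1. *)
have Sb n : `|pseries b x (j.+1 + n)%N - b j * x ^+ j| <=
    K * y ^+ j.+1 * (2 - 2 * y ^+ n).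
  elim: n => [|n IHn].
    rewrite addn0 expr0 mulr1 subrr mulr0 /pseries /series /= big_nat_recr //=.
    rewrite big_nat big1 ?add0r ?subrr ?normr0 // => i /andP[_ ij].
    by rewrite IHj // mul0r.
  rewrite addnS /pseries /series /= big_nat_recr //= addrAC.
  apply: le_trans (ler_normD _ _) _.
  have yn0 : 0 <= y ^+ n by rewrite exprn_ge0 // ltW.
  have yj0 : 0 <= K * y ^+ j.+1 by rewrite mulr_ge0 ?exprn_ge0 // ltW.
  have t1 : `|b (j.+1 + n)%N * x ^+ (j.+1 + n)| <= K * y ^+ j.+1 * y ^+ n.
    rewrite -mulrA -exprD /y expr_div_n mulrA ler_pdivlMr ?exprn_gt0 //.
    have := Kb (j.+1 + n)%N; rewrite -(ler_pM2r (exprn_gt0 (j.+1 + n) x0)).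
    by rewrite !normrM !normrX (gtr0_norm x0) (gtr0_norm r0) mulrAC.
  apply: le_trans (lerD IHn t1) _.
  rewrite -mulrDr ler_wpM2l // exprS; nra.
have lim : `|b j * x ^+ j| <= K * y ^+ j.+1 * 2.
  have c1 : (fun n => `|pseries b x (n + j.+1)%N - b j * x ^+ j|) @ \oo -->
      `|0 - b j * x ^+ j|.
    apply: cvg_norm; apply: cvgB; last exact: cvg_cst.
    by rewrite (cvg_shiftn j.+1 (pseries b x)).
  rewrite -normrN -sub0r; rewrite -(cvg_lim _ c1) //.
  apply: limr_le; first by apply/cvg_ex; exists `|0 - b j * x ^+ j|.
  apply: nearW => n; rewrite addnC; apply: le_trans (Sb n) _.
  rewrite ler_wpM2l ?mulr_ge0 ?exprn_ge0 ?(ltW K0) ?(ltW y0) //.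
  by rewrite lerBlDr lerDl mulr_ge0 ?exprn_ge0 // ltW.
move: lim; rewrite normrM normrX (gtr0_norm x0) /y expr_div_n.
move: xb; rewrite ltr_pdivlMr ?mulr_gt0 // => xb lim.
have : `|b j| * x ^+ j * r ^+ j.+1 <= K * 2 * x * x ^+ j.
  rewrite -ler_pdivlMr ?exprn_gt0 //; apply: le_trans lim _.
  by rewrite le_eqVlt; apply/orP; left; apply/eqP; rewrite [x ^+ j.+1]exprS; ring.
rewrite leNgt => /negP; case.
rewrite [ltRHS]mulrAC ltr_pM2r ?exprn_gt0 //.
by rewrite (_ : K * 2 * x = x * (2 * K)) //; ring.
Qed.

(** Otherwise the difference of the two spectral sums, a power series in the scale, vanishes at all
    1/(q + 1). All its coefficients are then zero, against [cyc_spectrum_power_sum_neq] at order 2(t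
    + 1). *)
Lemma exists_small_scale (R : realType) (f : R -> R) (a : nat -> R) t :
    (\forall x \near (0 : R), pseries a x @ \oo --> f x) ->
    a (2 * t.+1)%N != 0 ->
  exists q : nat,
    spectral_sum f (q.+1%:R^-1 *: (1%:M + cyc_mx t 1)) !=
    spectral_sum f (q.+1%:R^-1 *: (1%:M + cyc_mx t (-1))).
Proof.
move=> /nbhs_ballP[d /= d0 fd] a0; apply: contrapT => /forallNP eq_scale.
pose s := @cyc_spectrum R t.
have s_ge0 e i : 0 <= s e i by rewrite sqrtr_ge0.
(* [M] bounds both spectra, so [x * M < d] keeps every argument of [f] inside the ball where the
   expansion is valid. *)
pose M := 1 + \sum_i s 1 i + \sum_i s (-1) i.
have sum_ge0 e : 0 <= \sum_i s e i by rewrite sumr_ge0.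
have M0 : 0 < M by rewrite /M -addrA ltr_pwDl // addr_ge0.
have le_sum e i : s e i <= \sum_i s e i.
  by rewrite (bigD1 i) //= lerDl sumr_ge0.
have sM e i : e \in [:: 1; -1] -> s e i <= M.
  rewrite !inE => /orP[] /eqP ->; apply: le_trans (le_sum _ i) _.
    by rewrite /M addrAC lerDr addr_ge0.
  by rewrite /M lerDr addr_ge0.
pose S e j := \sum_i s e i ^+ j.
pose b j := a j * (S 1 j - S (-1) j).
have cvgS e x : e \in [:: 1; -1] -> 0 < x -> x * M < d ->
    (fun n => \sum_i pseries a (x * s e i) n) @ \oo --> \sum_i f (x * s e i).
  move=> e1 x0 xM; apply: cvg_big => [|i _]; first exact: add_continuous.
  apply: fd; rewrite /ball /= sub0r normrN ger0_norm ?mulr_ge0 // ?ltW //.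
  by apply: le_lt_trans xM; rewrite ler_wpM2l ?sM // ltW.
have cvgb x : 0 < x -> x * M < d -> pseries b x @ \oo -->
    \sum_i f (x * s 1 i) - \sum_i f (x * s (-1) i).
  move=> x0 xM; have -> : pseries b x = (fun n =>
      \sum_i pseries a (x * s 1 i) n - \sum_i pseries a (x * s (-1) i) n).
    apply/funext => n; rewrite /pseries /series /= exchange_big /=.
    rewrite [X in _ - X]exchange_big /= -sumrB; apply: eq_bigr => j _.
    rewrite /b mulrBr mulrBl; congr (_ - _); rewrite /S mulr_sumr mulr_suml;
    by apply: eq_bigr => i _; rewrite exprMn mulrA mulrAC.
  by apply: cvgB; apply: cvgS; rewrite // !inE eqxx ?orbT.
have r0 : 0 < d / (2 * M) by rewrite divr_gt0 ?mulr_gt0.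
have rM : d / (2 * M) * M < d.
  by rewrite invfM mulrA mulfVK ?gt_eqF // ltr_pdivrMr // ltr_pMr // ltr1n.
have cb : cvgn (pseries b (d / (2 * M))).
  by apply/cvg_ex; eexists; apply: cvgb.
suff /(pseries_eq0 r0 cb)/(_ (2 * t.+1)%N)/eqP : forall e, 0 < e ->
    exists x, [/\ 0 < x, x < e & pseries b x @ \oo --> 0].
  by rewrite mulf_eq0 (negPf a0) /= subr_eq0 (negPf (cyc_spectrum_power_sum_neq R t)).
move=> e e0; have em0 : 0 < Num.min e (d / M) by rewrite lt_min e0 divr_gt0.
have [q qe] : exists q : nat, q.+1%:R^-1 < Num.min e (d / M).
  have [N _ /(_ N (leqnn N))] := near_infty_natSinv_lt (PosNum em0).
  by exists N.
have q0 : 0 < q.+1%:R^-1 :> R by rewrite invr_gt0.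
exists q.+1%:R^-1; move: qe; rewrite lt_min => /andP[qe qd]; split=> //.
move: (eq_scale q) => /negP; rewrite negbK !(spectral_sumZ _ _ q0) => /eqP E.
have := @cvgb q.+1%:R^-1 q0; rewrite /s /cyc_spectrum E subrr; apply.
by rewrite -ltr_pdivlMr.
Qed.

(** * Correlation of parities with a short message *)

(** Use e^(-x) >= 1 - x and (1 + x + 2x^2)(1 - x) = 1 + x^2 (1 - 2x) >= 1. *)
Lemma expR_le_quadratic (R : realType) (x : R) :
  x <= 1 / 2 -> expR x <= 1 + x + 2 * x ^+ 2.
Proof.
move=> x2; have e0 := expR_gt0 (- x); have e1 := expR_ge1Dx (- x).
rewrite -[x in expR x]opprK expRN -(ler_pM2r e0) mulVf ?gt_eqF //.
have P0 : 0 <= 1 + x + 2 * x ^+ 2 by nra.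
apply: le_trans (ler_wpM2l P0 e1).
have : 0 <= x ^+ 2 * (1 - 2 * x) by rewrite mulr_ge0 ?sqr_ge0 //; lra.
lra.
Qed.

Lemma cosh_le_expR (R : realType) (x : R) :
  0 <= x <= 1 / 2 -> (expR x + expR (- x)) / 2 <= expR (2 * x ^+ 2).
Proof.
move=> /andP[x0 x2]; apply: le_trans (expR_ge1Dx _).
have := @expR_le_quadratic R x x2.
have /expR_le_quadratic : - x <= 1 / 2 by lra.
by rewrite sqrrN; lra.
Qed.

Lemma normr_sgb (R : numDomainType) b : `|sgb R b| = 1.
Proof. by rewrite /sgb normrX normrN1 expr1n. Qed.

Section Core.
Variables (R : realType) (V M : finType) (mu : {ffun V -> bool} -> M).
Variables (t l : nat) (u : 'I_t -> 'I_l -> V).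
Hypothesis u_inj : forall g k g' k', u g k = u g' k' -> g = g' /\ k = k'.

(** Slot [g] of the moved set may be placed at any of the [l] positions [u g k]; a function [i]
    chooses one position for each slot. *)
Definition pool : {set V} := [set u g k | g : 'I_t, k : 'I_l].

Definition agree_off (x y : {ffun V -> bool}) : bool :=
  [forall v, (v \in pool) || (x v == y v)].

(** The key collects all that a test function may depend on: the message, and [x] outside the
    pool. *)
Definition cell_key (x : {ffun V -> bool}) :
    M * {ffun {v | v \notin pool} -> bool} :=
  (mu x, [ffun v => x (val v)]).

Definition corr g (x y : {ffun V -> bool}) : R :=
  \sum_k sgb R (x (u g k)) * sgb R (y (u g k)).

(** For [y] uniform on the pool the [l] bits of slot [g] are independent signs, so the exponential
    moment factorises over positions. *)
Lemma corr_exp_moment g x th :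
  \sum_(y | agree_off x y) expR (th * corr g x y) =
  2 ^+ #|pool| * ((expR th + expR (- th)) / 2) ^+ l.
Proof.
pose sub := [set u g k | k : 'I_l].
pose W v (b : bool) : R :=
  if v \in sub then expR (th * (sgb R (x v) * sgb R b)) else 1.
pose Q v (b : bool) := (v \in pool) || (x v == b).
have ug_inj : injective (u g) by move=> k k' /u_inj[].
rewrite (eq_bigr (fun y : {ffun V -> bool} => \prod_v W v (y v))); last first.
  move=> y _; rewrite /corr mulr_sumr expR_sum -big_mkcond /= big_imset //=.
  by move=> k k' _ _; exact: ug_inj.
rewrite (eq_bigl (fun y : {ffun V -> bool} => y \in family Q)); last first.
  by move=> y; apply/forallP/familyP => h v; exact: h.
rewrite -(bigA_distr_big_dep Q W) /=.
rewrite (eq_bigr (fun v => (if v \in pool then 2 else 1) *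
   (if v \in sub then (expR th + expR (- th)) / 2 else 1))); last first.
  move=> v _; have subpool : v \in sub -> v \in pool.
    by move=> /imsetP[k _ ->]; apply/imset2P; exists g k.
  case: (boolP (v \in pool)) => vp; last first.
    have vs : v \in sub = false by apply: contraNF vp.
    rewrite (eq_bigl (pred1 (x v))) ?big_pred1_eq /W ?vs ?mulr1 // => b.
    by rewrite /Q (negPf vp) eq_sym.
  rewrite (eq_bigl xpredT) => [|b]; last by rewrite /Q vp.
  rewrite big_bool /W; case: (v \in sub); last by rewrite mulr1.
  rewrite [RHS]mulrCA mulfV ?pnatr_eq0 // mulr1.
  by case: (x v); rewrite /sgb /= ?expr0 ?expr1 ?mulr1 ?mul1r ?mulrNN ?mulr1
     ?mulrN ?mulr1 // addrC.
by rewrite big_split /= -!big_mkcond /= !prodr_const card_imset ?card_ord.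
Qed.

Lemma corr_tail g x lam : 0 <= lam <= 2 ->
  \sum_(y | agree_off x y) (lam * l%:R < `|corr g x y|)%R%:R <=
  2 * 2 ^+ #|pool| * expR (- (lam ^+ 2 / 8 * l%:R)) :> R.
Proof.
(* The Chernoff exponent 2 th^2 - th lam is least at th = lam / 4, with value -lam^2 / 8; [lam <= 2]
   gives th <= 1/2 as [cosh_le_expR] requires. *)
move=> /andP[lam0 lam2]; pose th := lam / 4.
pose K := expR (- (th * (lam * l%:R))).
have K0 : 0 <= K by exact: expR_ge0.
have step y : (lam * l%:R < `|corr g x y|)%R%:R <=
    K * (expR (th * corr g x y) + expR (- th * corr g x y)) :> R.
  case: ltP => /= [lc|_]; last by rewrite mulr_ge0 // addr_ge0 ?expR_ge0.
  have [c0|c0] := leP 0 (corr g x y).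
    rewrite mulrDr -[leLHS]addr0 lerD ?mulr_ge0 ?expR_ge0 //.
    rewrite -expRD -[leLHS]expR0 ler_expR addrC subr_ge0 ler_wpM2l ?divr_ge0 //.
    by rewrite -(ger0_norm c0) ltW.
  rewrite mulrDr -[leLHS]add0r lerD ?mulr_ge0 ?expR_ge0 //.
  rewrite -expRD -[leLHS]expR0 ler_expR addrC mulNr -mulrN subr_ge0.
  rewrite ler_wpM2l ?divr_ge0 //.
  by rewrite -(ltr0_norm c0) ltW.
apply: le_trans (ler_sum _ (fun y _ => step y)) _.
rewrite -mulr_sumr big_split /= !corr_exp_moment opprK [expR (- th) + _]addrC.
rewrite -[X in K * X]mulr2n -[X in K * X]mulr_natl mulrCA -!mulrA ler_wpM2l //.
rewrite [leLHS]mulrCA ler_wpM2l ?exprn_ge0 //.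
have ch : ((expR th + expR (- th)) / 2) ^+ l <= expR (2 * th ^+ 2) ^+ l.
  rewrite lerXn2r ?nnegrE ?divr_ge0 ?addr_ge0 ?expR_ge0 //.
  by apply: cosh_le_expR; rewrite /th; lra.
apply: le_trans (ler_wpM2l K0 ch) _.
rewrite -expRM_natr -expRD ler_expR /th le_eqVlt; apply/orP; left; apply/eqP.
by field.
Qed.

Definition vertex_char (i : {ffun 'I_t -> 'I_l}) (x : {ffun V -> bool}) : R :=
  \prod_g sgb R (x (u g (i g))).

Lemma normr_vertex_char i x : `|vertex_char i x| = 1.
Proof. by rewrite /vertex_char normr_prod big1 // => g _; rewrite normr_sgb. Qed.

(** Since the slots are placed independently, the second moment kernel is a product over slots. *)
Lemma sum_vertex_char x y :
  \sum_i vertex_char i x * vertex_char i y = \prod_g corr g x y.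
Proof.
rewrite /corr bigA_distr_bigA /=; apply: eq_bigr => i _.
by rewrite /vertex_char -big_split.
Qed.

Lemma corr_le g x y : `|corr g x y| <= l%:R.
Proof.
apply: le_trans (ler_norm_sum _ _ _) _.
under eq_bigr do rewrite normrM !normr_sgb mulr1.
by rewrite sumr_const card_ord.
Qed.

(** Either all slots have correlation at most [lam * l], or some indicator is 1 and the trivial
    bound [l ^ t] suffices. *)
Lemma prod_corr_le lam x y : 0 <= lam ->
  \prod_g corr g x y <=
  l%:R ^+ t * (lam ^+ t + \sum_g (lam * l%:R < `|corr g x y|)%R%:R).
Proof.
move=> lam0; apply: le_trans (ler_norm _) _; rewrite normr_prod.
case: (boolP [exists g, lam * l%:R < `|corr g x y|]) => [/existsP[g lg]|].
  apply: (@le_trans _ _ (l%:R ^+ t)).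
    rewrite -[t in leRHS]card_ord -prodr_const; apply: ler_prod => h _.
    by rewrite normr_ge0 corr_le.
  rewrite ler_peMr ?exprn_ge0 // (bigD1 g) //= lg mulr1n addrCA lerDl.
  by rewrite addr_ge0 ?exprn_ge0 // sumr_ge0.
rewrite negb_exists => /forallP small; rewrite mulrDr -[leLHS]addr0.
rewrite lerD ?mulr_ge0 ?exprn_ge0 ?sumr_ge0 // -exprMn mulrC.
rewrite -[t in leRHS]card_ord -prodr_const; apply: ler_prod => h _.
by rewrite normr_ge0 /= leNgt small.
Qed.

Lemma card_cell_key :
  #|{: M * {ffun {v | v \notin pool} -> bool}}|%:R * 2 ^+ #|pool| =
  #|M|%:R * 2 ^+ #|V| :> R.
Proof.
rewrite card_prod card_ffun card_bool card_sig natrM natrX -mulrA -exprD.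
by rewrite -[#|V|](cardC (mem pool)) addnC.
Qed.

Section Bound.
Variables (lam eta : R).
Hypotheses (lam_ge0 : 0 <= lam) (lam_le2 : lam <= 2) (eta_gt0 : 0 < eta).
Let kappa := 2 * expR (- (lam ^+ 2 / 8 * l%:R)).

Definition cell_sum c i : R := \sum_(x | cell_key x == c) vertex_char i x.
Definition cell_size c : R := \sum_(x | cell_key x == c) 1.

Lemma cell_key_agree x y : cell_key x = cell_key y -> agree_off x y.
Proof.
move=> [_ E]; apply/forallP => v; case: (boolP (v \in pool)) => //= vp.
by have /ffunP/(_ (exist _ v vp)) := E; rewrite !ffunE /= => ->.
Qed.

(** Expanding the square gives pairs [x], [y] of one cell weighted by the product of their
    correlations. For the rare large correlations, [y] is allowed to range over all vectors agreeing
    with [x] off the pool, where [corr_tail] applies. *)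
Lemma cell_sum_sqr c :
  \sum_i cell_sum c i ^+ 2 <=
  l%:R ^+ t * (cell_size c ^+ 2 * lam ^+ t +
               cell_size c * (t%:R * (2 ^+ #|pool| * kappa))).
Proof.
have -> : \sum_i cell_sum c i ^+ 2 =
    \sum_(x | cell_key x == c) \sum_(y | cell_key y == c) \prod_g corr g x y.
  under eq_bigr do rewrite expr2 big_distrlr /=.
  rewrite exchange_big /=; apply: eq_bigr => x _.
  rewrite exchange_big /=; apply: eq_bigr => y _.
  by rewrite sum_vertex_char.
apply: le_trans (ler_sum _ (fun x _ =>
  ler_sum _ (fun y _ => prod_corr_le x y lam_ge0))) _.
under eq_bigr do rewrite -mulr_sumr.
rewrite -mulr_sumr ler_wpM2l ?exprn_ge0 //.
rewrite expr2 -mulrA -mulrDr [cell_size c in leRHS]/cell_size mulr_suml.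
apply: ler_sum => x /eqP xc; rewrite mul1r big_split /= lerD //.
  by rewrite mulr_suml; under [leRHS]eq_bigr do rewrite mul1r.
have -> : t%:R = \sum_(g < t) 1 :> R by rewrite sumr_const card_ord.
rewrite exchange_big /= mulr_suml.
apply: ler_sum => g _; rewrite mul1r /kappa mulrA [_ * 2]mulrC.
apply: le_trans (corr_tail g x _); last by rewrite lam_ge0.
rewrite [leRHS](bigID (fun y => cell_key y == c)) /= -[leLHS]addr0 lerD ?sumr_ge0 //.
rewrite le_eqVlt; apply/orP; left; apply/eqP; apply: eq_bigl => y.
by case: (cell_key y =P c) => [yc|]; rewrite ?andbF // cell_key_agree // xc yc.
Qed.

(* On each cell, Phi i is constant and the second moment over i of the cell sum
   is controlled by cell_sum_sqr; AM-GM with weight [cell_size c * eta] turns it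
   into a first moment that can be summed over the cells. *)
Lemma correlation_bound (Phi : {ffun 'I_t -> 'I_l} -> {ffun V -> bool} -> R) :
    (forall i x, `|Phi i x| <= 1) ->
    (forall i x y, mu x = mu y -> agree_off x y -> Phi i x = Phi i y) ->
  \sum_i `|\sum_x vertex_char i x * Phi i x| <=
  l%:R ^+ t * 2 ^+ #|V| *
    (((lam ^+ t + #|M|%:R * (t%:R * kappa)) / eta + eta) / 2).
Proof.
move=> Phi1 Phi_cell.
have size_ge0 c : 0 <= cell_size c by rewrite sumr_ge0.
have to_cells i : `|\sum_x vertex_char i x * Phi i x| <=
    \sum_c `|cell_sum c i|.
  rewrite (partition_big cell_key xpredT) //=.
  apply: le_trans (ler_norm_sum _ _ _) _; apply: ler_sum => c _.
  have [/existsP[x0 /eqP x0c]|] := boolP [exists x0, cell_key x0 == c].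
    have -> : \sum_(x | cell_key x == c) vertex_char i x * Phi i x =
        cell_sum c i * Phi i x0.
      rewrite mulr_suml; apply: eq_bigr => x /eqP xc; congr (_ * _).
      have xx0 : cell_key x = cell_key x0 by rewrite xc x0c.
      by apply: Phi_cell (cell_key_agree xx0); case: xx0.
    by rewrite normrM ler_piMr.
  rewrite negb_exists => /forallP empty.
  by rewrite big_pred0 ?normr0 // => x; apply/negbTE.
apply: le_trans (ler_sum _ (fun i _ => to_cells i)) _.
rewrite exchange_big /=.
pose K : R := t%:R * (2 ^+ #|pool| * kappa).
have K0 : 0 <= K by rewrite !mulr_ge0 ?exprn_ge0 ?expR_ge0.
have per_cell c : \sum_i `|cell_sum c i| <=
    l%:R ^+ t * ((cell_size c * lam ^+ t + K) / eta + cell_size c * eta) / 2.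
  (* An empty cell has no usable AM-GM weight, but its sums vanish. *)
  have [s0|s_neq0] := eqVneq (cell_size c) 0.
    rewrite s0 !mul0r add0r addr0 big1 ?mulr_ge0 ?invr_ge0 ?exprn_ge0 // ?ltW //.
    move=> i _; apply/eqP; rewrite normr_eq0 -normr_le0.
    apply: (@le_trans _ _ (cell_size c)); last by rewrite s0.
    apply: le_trans (ler_norm_sum _ _ _) _.
    by apply: ler_sum => x _; rewrite normr_vertex_char.
  have s_gt0 : 0 < cell_size c by rewrite lt_def s_neq0 size_ge0.
  have se0 : 0 < cell_size c * eta by rewrite mulr_gt0.
  have amgm i : `|cell_sum c i| <=
      (cell_sum c i ^+ 2 / (cell_size c * eta) + cell_size c * eta) / 2.
    rewrite -(real_normK (num_real (cell_sum c i))).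
    rewrite ler_pdivlMr // -(ler_pM2r se0) mulrDl divfK ?gt_eqF //.
    by have := sqr_ge0 (`|cell_sum c i| - cell_size c * eta); nra.
  apply: le_trans (ler_sum _ (fun i _ => amgm i)) _.
  rewrite -mulr_suml ler_wpM2r ?invr_ge0 // big_split /= -mulr_suml.
  rewrite sumr_const card_ffun !card_ord mulrDr -[_ *+ (l ^ t)%N]mulr_natl natrX.
  rewrite lerD //.
  apply: le_trans (ler_wpM2r _ (cell_sum_sqr c)) _; first by rewrite invr_ge0 ltW.
  rewrite -/K -mulrA ler_wpM2l ?exprn_ge0 // expr2 -mulrA -mulrDr invfM.
  by rewrite mulrACA divff // mul1r.
apply: le_trans (ler_sum _ (fun c _ => per_cell c)) _.
have sizes : \sum_c cell_size c = 2 ^+ #|V|.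
  transitivity (\sum_(x : {ffun V -> bool}) 1 : R).
    by rewrite (partition_big cell_key xpredT).
  by rewrite sumr_const card_ffun card_bool natrX.
rewrite -mulr_suml -mulr_sumr big_split /= -!mulr_suml big_split /= -mulr_suml.
rewrite sizes sumr_const -[K *+ _]mulr_natl.
(* The number of cells times 2^|pool| is |M| 2^|V|: this is how the message length enters the
   bound. *)
have -> : #|{: M * {ffun {v | v \notin pool} -> bool}}|%:R * K =
    2 ^+ #|V| * (#|M|%:R * (t%:R * kappa)).
  by rewrite /K mulrCA [_ * (2 ^+ #|pool| * _)]mulrA card_cell_key; ring.
by rewrite le_eqVlt; apply/orP; left; apply/eqP; ring.
Qed.

End Bound.
End Core.

(** * The one-way communication bound *)

Section Hybrid.
Variables (R : realType) (t l q : nat).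
Hypothesis lq : (l * t.+1 <= q)%N.
Local Notation N := (l * t.+1 + q)%N.

Definition free_vertex (g : 'I_t.+1) (k : 'I_l) : 'I_N :=
  rshift (l * t.+1) (widen_ord lq (block_index k g)).

Lemma free_vertex_inj g k g' k' :
  free_vertex g k = free_vertex g' k' -> g = g' /\ k = k'.
Proof.
move=> /rshift_inj /(congr1 val) /= E.
have {}E : block_index k g = block_index k' g' by exact: val_inj.
by have [-> ->] := block_index_inj E.
Qed.

Lemma edge_inj (j j' : 'I_l) (g g' : 'I_t.+1) :
  edge q j g = edge q j' g' -> j = j' /\ g = g'.
Proof. by move=> /lshift_inj /block_index_inj. Qed.

Lemma edge_neq_free (j : 'I_l) (g : 'I_t.+1) g' k :
  (edge q j g == free_vertex g' k) = false.
Proof. exact: eq_lrshift. Qed.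

(** The involution exchanges slot [g] of edge [j] with its chosen free position, and fixes
    everything else. *)
Lemma exists_edge_swap (j : 'I_l) (i : {ffun 'I_t.+1 -> 'I_l}) :
  exists tau : {perm 'I_N}, (forall g, tau (edge q j g) = free_vertex g (i g)) /\
    forall j' g, j' != j -> tau (edge q j' g) = edge q j' g.
Proof.
pose swap v := if [pick g | v == edge q j g] is Some g then free_vertex g (i g)
  else if [pick g | v == free_vertex g (i g)] is Some g then edge q j g else v.
have swapE g : swap (edge q j g) = free_vertex g (i g).
  rewrite /swap; case: pickP => [g' /eqP/edge_inj[_ ->]//|/(_ g)].
  by rewrite eqxx.
have swapF g : swap (free_vertex g (i g)) = edge q j g.
  rewrite /swap; case: pickP => [g'|_]; first by rewrite eq_sym edge_neq_free.
  case: pickP => [g' /eqP/free_vertex_inj[-> _]//|/(_ g)]; by rewrite eqxx.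
have swapK : involutive swap.
  move=> v; rewrite {2}/swap; case: pickP => [g /eqP ->|nE]; first exact: swapF.
  case: pickP => [g /eqP ->|nF]; first exact: swapE.
  rewrite /swap; case: pickP => [g|_]; first by rewrite nE.
  by case: pickP => [g|//]; rewrite nF.
exists (perm (inv_inj swapK)); split=> [g|j' g jj']; rewrite permE //.
rewrite /swap; case: pickP => [g' /eqP/edge_inj[E]|_].
  by rewrite E eqxx in jj'.
by case: pickP => [g'|//]; rewrite edge_neq_free.
Qed.

Variables (M : finType) (mu : {ffun 'I_N -> bool} -> M).
Variable G : M -> {perm 'I_N} -> {ffun 'I_l -> bool} -> R.
Hypothesis G01 : forall a p w, 0 <= G a p w <= 1.
Variables (lam eta : R).
Hypotheses (lam_ge0 : 0 <= lam) (lam_le2 : lam <= 2) (eta_gt0 : 0 < eta).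

(** Right-hand side of [correlation_bound] for sets of t + 1 positions, divided by
    [l ^ t.+1 * 2 ^ N]. *)
Definition hybrid_gap : R :=
  ((lam ^+ t.+1 + #|M|%:R *
     (t.+1%:R * (2 * expR (- (lam ^+ 2 / 8 * l%:R))))) / eta + eta) / 2.

Definition flip_first k (w : {ffun 'I_l -> bool}) : {ffun 'I_l -> bool} :=
  [ffun j => w j (+) (j < k)%N].

Definition hybrid k : R :=
  \sum_p \sum_x G (mu x) p (flip_first k (parity x p)).

(* Composing p with the swaps tau i moves the k-th edge to unused positions
   without changing the sum over p, and leaves the other edges in place. *)
Lemma hybrid_step k : (k < l)%N ->
  hybrid k.+1 - hybrid k <= #|{: {perm 'I_N}}|%:R * (2 ^+ N * hybrid_gap).
Proof.
move=> kl; pose j := Ordinal kl.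
(* Consecutive hybrids differ only in bit [j], which moves from the parity to its complement. The
   change is [Phi], the difference of [G] in that bit, times the character of [x] on edge [j]. *)
pose w (p : {perm 'I_N}) (x : {ffun 'I_N -> bool}) b :=
  [ffun j' => if j' == j then b else parity x p j' (+) (j' < k)%N].
pose Phi (p : {perm 'I_N}) x := G (mu x) p (w p x true) - G (mu x) p (w p x false).
pose T (p : {perm 'I_N}) := \sum_x sgb R (parity x p j) * Phi p x.
have -> : hybrid k.+1 - hybrid k = \sum_p T p.
  rewrite -sumrB; apply: eq_bigr => p _; rewrite -sumrB; apply: eq_bigr => x _.
  have -> : flip_first k.+1 (parity x p) = w p x (~~ parity x p j).
    apply/ffunP => j'; rewrite ffunE [RHS]ffunE ltnS leq_eqVlt.
    rewrite -[nat_of_ord j' == k]/(j' == j).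
    by case: (j' =P j) => [->|//]; rewrite addbT.
  have -> : flip_first k (parity x p) = w p x (parity x p j).
    apply/ffunP => j'; rewrite ffunE [RHS]ffunE.
    by case: (j' =P j) => [->|//]; rewrite ltnn addbF.
  by case: (parity x p j); rewrite /sgb /Phi /= ?expr0 ?expr1 ?mul1r ?mulN1r ?opprB.
have l0 : (0 : R) < l%:R ^+ t.+1 by rewrite exprn_gt0 // ltr0n (leq_ltn_trans _ kl).
have /choice[tau tauP] := exists_edge_swap j.
rewrite -(ler_pM2l l0); apply: (@le_trans _ _
  (\sum_p \sum_(i : {ffun 'I_t.+1 -> 'I_l}) `|T (tau i * p)%g|)).
  have -> : l%:R ^+ t.+1 * \sum_p T p =
      \sum_(i : {ffun 'I_t.+1 -> 'I_l}) \sum_p T (tau i * p)%g.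
    transitivity (\sum_(i : {ffun 'I_t.+1 -> 'I_l}) \sum_p T p).
      by rewrite sumr_const card_ffun !card_ord -[RHS]mulr_natl natrX.
    by apply: eq_bigr => i _; rewrite (reindex_inj (mulgI (tau i))).
  rewrite exchange_big /=; apply: ler_sum => p _; apply: ler_sum => i _.
  exact: ler_norm.
rewrite mulrCA mulr_natl -sumr_const; apply: ler_sum => p _.
have up_inj g k' g' k'' : p (free_vertex g k') = p (free_vertex g' k'') ->
    g = g' /\ k' = k'' by move=> /perm_inj/free_vertex_inj.
have Phi1 (i : {ffun 'I_t.+1 -> 'I_l}) x : `|Phi (tau i * p)%g x| <= 1.
  rewrite /Phi ler_norml.
  have /andP[a0 a1] := G01 (mu x) (tau i * p)%g (w (tau i * p)%g x true).
  have /andP[b0 b1] := G01 (mu x) (tau i * p)%g (w (tau i * p)%g x false).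
  by apply/andP; split; lra.
have PhiE (i : {ffun 'I_t.+1 -> 'I_l}) x y : mu x = mu y ->
    agree_off (fun g k' => p (free_vertex g k')) x y ->
    Phi (tau i * p)%g x = Phi (tau i * p)%g y.
  move=> xy /forallP agree.
  (* The bits other than [j] are parities over edges that [tau i] fixes and that miss the pool,
     where [x] and [y] agree. *)
  have wE b : w (tau i * p)%g x b = w (tau i * p)%g y b.
    apply/ffunP => j'; rewrite !ffunE; case: (j' =P j) => // /eqP jj'.
    congr (_ (+) _); apply: eq_bigr => g _; rewrite permM (tauP i).2 //.
    have /orP[/imset2P[g' k' _ _ /perm_inj/eqP]|/eqP//] := agree (p (edge q j' g)).
    by rewrite edge_neq_free.
  by rewrite /Phi xy !wE.
have := correlation_bound up_inj lam_ge0 lam_le2 eta_gt0 Phi1 PhiE.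
rewrite card_ord -mulrA; apply: le_trans; apply: ler_sum => i _.
(* Under [tau i * p] edge [j] sits at the positions [p (free_vertex g (i g))], so its parity
   character is [vertex_char]. *)
rewrite le_eqVlt; apply/orP; left; apply/eqP; congr (`| _ |).
apply: eq_bigr => x _; congr (_ * _); rewrite sgb_parity.
by apply: eq_bigr => g _; rewrite permM (tauP i).1.
Qed.

Lemma hybrid_bound :
  \sum_p \sum_x G (mu x) p [ffun j => ~~ parity x p j] <=
  \sum_p \sum_x G (mu x) p (parity x p) +
  l%:R * (#|{: {perm 'I_N}}|%:R * (2 ^+ N * hybrid_gap)).
Proof.
have <- : hybrid l = \sum_p \sum_x G (mu x) p [ffun j => ~~ parity x p j].
  apply: eq_bigr => p _; apply: eq_bigr => x _; congr G.
  by apply/ffunP => j; rewrite ffunE [RHS]ffunE ltn_ord addbT.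
have <- : hybrid 0 = \sum_p \sum_x G (mu x) p (parity x p).
  apply: eq_bigr => p _; apply: eq_bigr => x _; congr G.
  by apply/ffunP => j; rewrite ffunE ltn0 addbF.
rewrite -lerBlDl -(telescope_sumr hybrid (leq0n l)) big_mkord.
rewrite -[l in l%:R]card_ord mulr_natl -sumr_const.
by apply: ler_sum => k _; apply: hybrid_step.
Qed.

End Hybrid.

(** * Parameters that make the total hybrid gap small *)

Lemma leq_add4 a b c d n : (a + b + c + d <= n)%N ->
  [/\ a <= n, b <= n, c <= n & d <= n]%N.
Proof. by move=> h; split; lia. Qed.

(* With y = N^(1 / (2 m (m + 1))), lam = y^-m and N^(1 - 1/m) are integral
   powers of y. *)
Lemma hybrid_gap_small (R : realType) (m t : nat) (delta : R) :
    (0 < m)%N -> (8 * m.+1 <= t.+1)%N -> 0 < delta ->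
  exists N0 : nat, forall (N l S : nat) (M : finType),
    #|M| = (2 ^ S)%N -> (N0 <= N)%N -> l = (N %/ (2 * t.+1))%N ->
    S%:R < N%:R `^ (1 - m%:R^-1) :> R ->
  exists lam eta : R, [/\ 0 <= lam, lam <= 2, 0 < eta &
    l%:R * hybrid_gap t l M lam eta <= delta].
Proof.
move=> m0 mt d0; set T := t.+1.
(* The power 10 suffices for all m >= 1: with [A] below, A^10 = y^(20 m^2) >= y^(10 m (m + 1)) =
   N^5. *)
have [F F0 expF] : exists2 F : nat, (0 < F)%N &
    forall x : R, 0 <= x -> x ^+ 10 / F%:R <= expR x.
  exists (10`!)%N; first exact: fact_gt0.
  by move=> x x0; apply: le_trans (expR_ge1Dxn 9 x0); rewrite lerDr.
pose e := (2 * m * m.+1)%N.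
have e0 : (0 < e)%N by rewrite /e; lia.
(* The summands ensure in turn y >= 64T, that one factor N absorbs the constants in [KN], that l >=
   2, and that delta N >= 2. *)
exists ((64 * T) ^ e + 2 * T * (F * (64 * T) ^ 10) + 4 * T +
        Num.bound (2 / delta))%N.
move=> N l S M cM NN0 lN SN.
have [N1 N2 N3 N4] := leq_add4 NN0.
clear NN0.
have {}N2 : 2 * T%:R * (F%:R * (64 * T)%:R ^+ 10) <= N%:R :> R.
  by rewrite -!natrX -!natrM ler_nat.
have Npos : (0 < N)%N by apply: leq_trans N3.
have NR : (0 : R) < N%:R by rewrite ltr0n.
have dN : 2 <= delta * N%:R.
  rewrite mulrC -ler_pdivrMr //.
  have b0 : 0 <= 2 / delta by rewrite divr_ge0 // ltW.
  by apply: (le_trans (ltW (archi_boundP b0))); rewrite ler_nat.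
pose y : R := N%:R `^ (e%:R^-1).
have y0 : 0 < y by rewrite powR_gt0.
have ye : y ^+ e = N%:R.
  rewrite -powR_mulrn ?(ltW y0) // -powRrM mulVf ?powRr1 ?(ltW NR) //.
  by rewrite pnatr_eq0 -lt0n.
have yT : (64 * T)%:R <= y.
  by rewrite -(ler_pXn2r e0) ?nnegrE ?(ltW y0) ?ler0n // ye -natrX ler_nat.
clear N1.
have T1 : 1 <= T%:R :> R by rewrite ler1n.
have y1 : 1 <= y by apply: le_trans yT; rewrite ler1n muln_gt0.
(* [A] equals both y^2 N^(1 - 1/m), which dominates 64 T S, and lam^2 N, which is at most 4 T lam^2
   l. *)
pose A := y ^+ (2 * m * m).
have A0 : 0 < A by rewrite exprn_gt0.
have SA : S%:R * (64 * T)%:R <= A.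
  have -> : A = y ^+ (2 * m.+1 * m.-1) * y ^+ 2.
    by rewrite -exprD; congr (_ ^+ _); clear -m0; case: m m0 => // m' _ /=; lia.
  have -> : y ^+ (2 * m.+1 * m.-1) = N%:R `^ (1 - m%:R^-1).
    rewrite -ye -(powR_mulrn e (ltW y0)) -powRrM.
    rewrite -(powR_mulrn _ (ltW y0)); congr (_ `^ _).
    rewrite /e; clear -m0; case: m m0 => // m' _ /=.
    rewrite !natrM -[m'.+2]addn1 natrD -[m'.+1]addn1 natrD.
    by field; rewrite natr1 pnatr_eq0.
  apply: ler_pM; rewrite ?ler0n ?(ltW SN) //.
  by apply: le_trans yT _; rewrite expr2 ler_peMr // ltW.
have lN4 : N%:R <= l%:R * (4 * T)%:R :> R.
  rewrite -natrM ler_nat; have := @ltn_ceil N (2 * T) (ltn0Sn _); rewrite -lN => h1.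
  have : (2 <= l)%N by rewrite lN leq_divRL // mulnA.
  by move: h1; clear; nia.
have lN1 : l%:R <= N%:R :> R by rewrite ler_nat lN leq_div.
(* As T >= 8(m + 1), lam^T <= N^-4; [eta] is the square root of this bound, which balances the two
   terms of the gap. *)
exists (y ^- m), (N%:R ^- 2).
have lam0 : 0 < y ^- m by rewrite invr_gt0 exprn_gt0.
have lam1 : y ^- m <= 1 by rewrite invf_le1 ?exprn_gt0 // exprn_ege1.
have lamT : (y ^- m) ^+ T <= N%:R ^- 4.
  apply: le_trans (ler_wiXn2l (ltW lam0) lam1 mt) _.
  rewrite -ye exprVn -!exprM le_eqVlt; apply/orP; left; apply/eqP.
  by congr (_ ^- _); rewrite /e; clear; lia.
have lamA : A <= (y ^- m) ^+ 2 * l%:R * (4 * T)%:R.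
  rewrite -mulrA; apply: le_trans (ler_wpM2l _ lN4); last by rewrite exprn_ge0 // ltW.
  rewrite -ye exprVn -exprM mulrC ler_pdivlMr ?exprn_gt0 // -exprD.
  rewrite le_eqVlt; apply/orP; left; apply/eqP; congr (_ ^+ _).
  by rewrite /e; clear; lia.
pose K : R := #|M|%:R *
  (T%:R * (2 * expR (- ((y ^- m) ^+ 2 / 8 * l%:R)))).
pose X := A / (64 * T)%:R.
have X0 : 0 < X by rewrite divr_gt0 // ltr0n.
have XN : N%:R ^+ 5 <= X ^+ 10 * (64 * T)%:R ^+ 10.
  rewrite -exprMn /X mulfVK ?pnatr_eq0 // /A -exprM -ye -exprM.
  by apply: ler_weXn2l => //; rewrite /e; clear -m0; nia.
have KN : K <= N%:R ^- 4.
  have K1 : K <= 2 * T%:R * expR (- X).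
    rewrite /K cM natrX mulrCA [_ * (2 * _)]mulrCA -!mulrA [2 * (T%:R * _)]mulrCA.
    rewrite !ler_wpM2l ?ler0n //.
    (* With X = A / (64T), S <= X while lam^2 l / 8 >= 2X, so the exponent is at most -X. *)
    have e2 : 2 ^+ S <= expR S%:R :> R.
      rewrite -[S%:R]mulr1 expRM_natl lerXn2r ?nnegrE ?expR_ge0 //.
      exact: expR_ge1Dx.
    apply: le_trans (ler_wpM2r (expR_ge0 _) e2) _.
    rewrite -expRD ler_expR.
    have : S%:R <= X by rewrite /X ler_pdivlMr ?ltr0n.
    have : A / (4 * T)%:R <= (y ^- m) ^+ 2 * l%:R by rewrite ler_pdivrMr ?ltr0n.
    have -> : A / (4 * T)%:R = 16 * X.
      by rewrite /X !natrM; field; rewrite pnatr_eq0.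
    by lra.
  apply: le_trans K1 _; rewrite expRN.
  have N5 : N%:R ^+ 5 <= expR X * (F%:R * (64 * T)%:R ^+ 10).
    apply: le_trans XN _; rewrite mulrA ler_wpM2r ?exprn_ge0 ?ler0n //.
    by rewrite -ler_pdivrMr ?ltr0n //; apply: expF; rewrite ltW.
  rewrite ler_pdivrMr ?expR_gt0 // [leRHS]mulrC ler_pdivlMr ?exprn_gt0 //.
  rewrite -(ler_pM2r NR) -[leLHS]mulrA -exprSr.
  apply: le_trans (ler_wpM2l _ N5) _; first by rewrite mulr_ge0.
  by rewrite mulrCA ler_wpM2l ?expR_ge0.
split=> //; [exact: ltW|by lra|by rewrite invr_gt0 exprn_gt0|].
have n0 := gt_eqF NR.
have bound : ((y ^- m) ^+ T + K) / N%:R ^- 2 + N%:R ^- 2 <= 3 * N%:R ^- 2.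
  have -> : 3 * N%:R ^- 2 = (N%:R ^- 4 + N%:R ^- 4) / N%:R ^- 2 + N%:R ^- 2 :> R.
    by field; rewrite n0.
  by rewrite lerD2r ler_wpM2r ?invr_ge0 ?exprn_ge0 ?ler0n // lerD.
rewrite /hybrid_gap -/T -/K.
apply: (@le_trans _ _ (N%:R * (3 * N%:R ^- 2 / 2))).
  apply: (@le_trans _ _ (l%:R * (3 * N%:R ^- 2 / 2))).
    by rewrite ler_wpM2l ?ler0n // ler_wpM2r ?invr_ge0.
  by rewrite ler_wpM2r // divr_ge0 // mulr_ge0 // invr_ge0 exprn_ge0 // ler0n.
have -> : N%:R * (3 * N%:R ^- 2 / 2) = 3 / 2 / N%:R :> R by field; rewrite n0.
by rewrite ler_pdivrMr //; lra.
Qed.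

(** * Streams *)

Definition entry_update (R : realType) N (A : 'M[R]_N) (ij : 'I_N * 'I_N) :
    update R N := (ij.1, ij.2, A ij.1 ij.2).

(** Zero entries are sent too, so the length does not depend on the matrix and Bob starts at a fixed
    time. *)
Definition matrix_stream (R : realType) N (A : 'M[R]_N) : seq (update R N) :=
  map (entry_update A) (enum {: 'I_N * 'I_N}).

Lemma foldl_entry_update (R : realType) N (A X : 'M[R]_N) s i j :
  foldl (@apply_update R N) X (map (entry_update A) s) i j =
  X i j + A i j *+ count_mem (i, j) s.
Proof.
elim: s X => [|[a b] s IHs] X /=; first by rewrite mulr0n addr0.
rewrite IHs !mxE /= -addrA mulrnDr; congr (_ + (_ + _)).
rewrite xpair_eqE [i == a]eq_sym [j == b]eq_sym.
by case: eqP => [->|_]; case: eqP => [->|_]; rewrite ?mulr1 ?mulr0.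
Qed.

Lemma stream_matrix_cat (R : realType) N (A B : 'M[R]_N) :
  stream_matrix (matrix_stream A ++ matrix_stream B) = A + B.
Proof.
apply/matrixP => i j; rewrite /stream_matrix foldl_cat !foldl_entry_update !mxE.
by rewrite !count_uniq_mem ?enum_uniq // !mem_enum add0r.
Qed.

Lemma stream_matrix_prefix (R : realType) N (A B : 'M[R]_N) n i j :
  exists a b : bool, stream_matrix
    (take n (matrix_stream A ++ matrix_stream B)) i j = A i j *+ a + B i j *+ b.
Proof.
rewrite take_cat; case: ifP => _.
  exists ((i, j) \in take n (enum {: 'I_N * 'I_N})), false.
  rewrite -map_take /stream_matrix foldl_entry_update mxE add0r addr0.
  by rewrite count_uniq_mem // take_uniq // enum_uniq.
set n' := (n - _)%N.
exists true, ((i, j) \in take n' (enum {: 'I_N * 'I_N})).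
rewrite -map_take /stream_matrix foldl_cat !foldl_entry_update mxE add0r.
by rewrite !count_uniq_mem ?take_uniq ?enum_uniq // mem_enum.
Qed.

Lemma log_bits_unit_fraction (R : realType) k N q (z : R) :
  (0 < k)%N -> (q.+1 <= N)%N ->
  z \in [:: 0; q.+1%:R^-1; - q.+1%:R^-1] -> log_bits k N z.
Proof.
move=> k0 qN; have qNk : (q.+1 <= N ^ k)%N.
  by apply: (leq_trans qN); rewrite -[leqLHS]expn1 leq_pexp2l // (leq_trans _ qN).
have Nk0 : (0 < N ^ k)%N by exact: leq_trans qNk.
rewrite !inE => /or3P[] /eqP ->.
- by exists 0, 1%N; split; rewrite ?mul0r.
- by exists 1, q.+1; split; rewrite ?qNk ?mul1r.
- by exists (-1), q.+1; split; rewrite ?qNk ?mulN1r.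
Qed.

Lemma sa_run_cat (R : realType) (Omega : Type) N S (A : stream_alg R Omega N S)
    w n a s1 s2 :
  sa_run A w n a (s1 ++ s2) = sa_run A w (n + size s1) (sa_run A w n a s1) s2.
Proof.
elim: s1 n a => [|u s1 IHs] n a /=; first by rewrite addn0.
by rewrite IHs addSnnS.
Qed.

(** Integrating a pointwise bound reduces the randomized algorithm to a fixed outcome [w] of its
    random bits. *)
Lemma sum_probability_le (R : realType) d (Omega : measurableType d)
    (P : probability Omega R) (I : finType) (A : I -> set Omega) (K : R) :
  (forall i, measurable (A i)) -> (forall w, \sum_i \1_(A i) w <= K) ->
  (\sum_i P (A i) <= K%:E)%E.
Proof.
move=> mA AK; pose F i w := (\1_(A i) w : R)%:E.
have mF i : measurable_fun [set: Omega] (F i).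
  by apply/measurable_EFinP; exact: measurable_indic.
have F0 i w : (0 <= F i w)%E by rewrite lee_fin indicE.
rewrite (eq_bigr (fun i => \int[P]_w F i w)%E) => [|i _]; last first.
  by rewrite /F integral_indic // setIT.
rewrite -ge0_integral_sum //.
have -> : K%:E = (\int[P]_w K%:E)%E.
  rewrite integral_cst // -[LHS]mule1; congr (_ * _)%E.
  exact/esym/probability_setT.
apply: ge0_le_integral => //.
- by move=> w _; apply: sume_ge0.
- exact: emeasurable_sum.
- by move=> w _; rewrite /F sumEFin lee_fin.
Qed.

(** * Reduction from streaming to one-way communication *)

Definition hard_value (R : realType) (f : R -> R) t (c : R) (l q : nat)
    (b : bool) : R :=
  l%:R * spectral_sum f (c *: (1%:M + cyc_mx t (sgb R b))) + q%:R * f c.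

(** For fixed [w] the memory after Alice's updates is a function of [x]. By [hybrid_bound], success
    on the complemented word hardly exceeds the chance of giving the same kind of answer on the
    parity word, and there no output is correct for both values. *)
Lemma streaming_success_bound (R : realType) (f : R -> R) (t l q r k : nat)
    (c eps lam eta : R) d (Omega : measurableType d) (P : probability Omega R)
    S (A : stream_alg R Omega (l * t.+1 + q)%N S) :
    (0 < t)%N -> (l * t.+1 <= q)%N -> (0 < k)%N -> (r.+1 <= l * t.+1 + q)%N ->
    0 <= lam -> lam <= 2 -> 0 < eta ->
    (forall v, approximation c (hard_value f t r.+1%:R^-1 l q false) v ->
      approximation c (hard_value f t r.+1%:R^-1 l q true) v -> False) ->
    approximates_spectral_sum f k c eps P A ->
  2 * (1 - eps) <= 1 + l%:R * hybrid_gap t l (S.-tuple bool) lam eta.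
Proof.
set N := (l * t.+1 + q)%N in A *; set sc : R := r.+1%:R^-1.
move=> t0 lq k0 rN lam0 lam2 eta0 separated A_approx.
have sc0 : 0 < sc by rewrite invr_gt0.
pose F b := hard_value f t sc l q b.
pose word (x : {ffun 'I_N -> bool}) (p : {perm 'I_N}) b :=
  [ffun j => parity x p j (+) b] : {ffun 'I_l -> bool}.
pose s x p b := matrix_stream (alice_mx sc x) ++
  matrix_stream (bob_mx sc p (word x p b)).
pose good b p x := [set w | approximation c (F b) (sa_result A w (s x p b))].
have goodP b p x : measurable (good b p x) /\ ((1 - eps)%:E <= P (good b p x))%E.
  have log_s : log_bits_stream k (s x p b).
    move=> n i j; have [a1 [a2 ->]] := stream_matrix_prefix
      (alice_mx sc x) (bob_mx sc p (word x p b)) n i j.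
    apply: (log_bits_unit_fraction k0 rN).
    have := alice_mx_entry sc x i j; have := bob_mx_entry sc p (word x p b) i j t0.
    case: eqP => _ /= => [-> ain|bin ->]; rewrite mul0rn ?addr0 ?add0r.
      by case: a1; rewrite ?mulr1n ?mulr0n ?mem_head // inE ain orbT.
    by case: a2; rewrite ?mulr1n ?mulr0n ?mem_head.
  have := A_approx _ log_s.
  by rewrite stream_matrix_cat (spectral_sum_hard_instance sc0).
pose I : finType := (bool * ({perm 'I_N} * {ffun 'I_N -> bool}))%type.
pose K : R := #|{: {perm 'I_N}}|%:R *
  (2 ^+ N * (1 + l%:R * hybrid_gap t l (S.-tuple bool) lam eta)).
have pointwise w : \sum_(i : I) \1_(good i.1 i.2.1 i.2.2) w <= K.
  pose T0 := size (enum {: 'I_N * 'I_N}).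
  pose mu (x : {ffun 'I_N -> bool}) :=
    sa_run A w 0 (sa_init A w) (matrix_stream (alice_mx sc x)).
  pose G b a (p : {perm 'I_N}) v : R := (`[< approximation c (F b)
    (sa_output A w (sa_run A w T0 a (matrix_stream (bob_mx sc p v)))) >])%:R.
  have G01 b a p v : 0 <= G b a p v <= 1.
    by rewrite /G; case: asbool; rewrite lexx ler01.
  have goodE b p x : \1_(good b p x) w = G b (mu x) p (word x p b).
    rewrite indicE /G /mu /T0 -(size_map (entry_update (alice_mx sc x))).
    by rewrite -[size _]add0n -sa_run_cat.
  rewrite -(pair_bigA _ (fun b (j : {perm 'I_N} * {ffun 'I_N -> bool}) =>
    \1_(good b j.1 j.2) w)) big_bool /=.
  rewrite -(pair_bigA _ (fun p x => \1_(good true p x) w)) /=.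
  rewrite -(pair_bigA _ (fun p x => \1_(good false p x) w)) /=.
  have -> : \sum_p \sum_x \1_(good true p x) w =
      \sum_p \sum_x G true (mu x) p [ffun j => ~~ parity x p j].
    apply: eq_bigr => p _; apply: eq_bigr => x _; rewrite goodE; congr (G _ _ _).
    by apply/ffunP => j; rewrite ffunE [RHS]ffunE addbT.
  have -> : \sum_p \sum_x \1_(good false p x) w =
      \sum_p \sum_x G false (mu x) p (parity x p).
    apply: eq_bigr => p _; apply: eq_bigr => x _; rewrite goodE; congr (G _ _ _).
    by apply/ffunP => j; rewrite ffunE addbF.
  have := hybrid_bound lq mu (G01 true) lam0 lam2 eta0.
  rewrite -(lerD2r (\sum_p \sum_x G false (mu x) p (parity x p))).
  move=> h; apply: le_trans h _; rewrite addrAC -big_split /=.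
  rewrite /K !mulrDr mulr1 mulrCA [2 ^+ N * (_ * _)]mulrCA lerD2r.
  rewrite mulr_natl -sumr_const; apply: ler_sum => p _.
  have -> : 2 ^+ N = \sum_(x : {ffun 'I_N -> bool}) 1 :> R.
    by rewrite sumr_const card_ffun card_bool card_ord natrX.
  rewrite -big_split /=; apply: ler_sum => x _; rewrite /G.
  (* Both indicators refer to the same output, so [separated] forbids that both are 1. *)
  case: asboolP => [h1|_]; case: asboolP => [h0|_]; rewrite ?addr0 ?add0r //.
  by case: (separated _ h0 h1).
have := @sum_probability_le R d Omega P I (fun i => good i.1 i.2.1 i.2.2) K
   (fun i => (goodP _ _ _).1) pointwise.
have : (\sum_(i : I) (1 - eps)%:E <= \sum_(i : I) P (good i.1 i.2.1 i.2.2))%E.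
  by apply: lee_sum => i _; exact: (goodP _ _ _).2.
move=> /le_trans h /h; rewrite sumEFin lee_fin sumr_const.
have -> : #|I| = (2 * (#|{: {perm 'I_N}}| * 2 ^ N))%N.
  by rewrite !card_prod card_bool card_ffun card_bool card_ord.
have pos : 0 < #|{: {perm 'I_N}}|%:R * 2 ^+ N :> R.
  by rewrite mulr_gt0 ?exprn_gt0 // ltr0n; apply/card_gt0P; exists 1%g.
rewrite -[leLHS]mulr_natr !natrM natrX /K [_ * (2 ^+ N * _)]mulrA => hK.
rewrite -(ler_pM2l pos); apply: le_trans hK.
by rewrite le_eqVlt; apply/orP; left; apply/eqP; ring.
Qed.

Theorem theorem10 (R : realType) (f : R -> R) (a : nat -> R)
    (f_taylor : \forall x \near (0 : R), pseries a x @ \oo --> f x)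
    (a_even : infinite_set [set j | ~~ odd j /\ a j != 0])
    (m : nat) (m_gt0 : (0 < m)%N) :
  exists2 c : R, 0 < c &
    forall (k : nat) (eps : R), (0 < k)%N -> 0 <= eps < 1 / 2 ->
    exists2 C : R, 0 < C &
    exists N0 : nat, forall (N S : nat) (d : measure_display)
        (Omega : measurableType d) (P : probability Omega R)
        (A : stream_alg R Omega N S),
      (N0 <= N)%N ->
      approximates_spectral_sum f k c eps P A ->
      C * N%:R `^ (1 - m%:R^-1) <= S%:R.
Proof.
(* Some even index 2(t + 1) with nonzero coefficient lies beyond 16(m + 1), since there are
   infinitely many. *)
have [t mt at0] : exists2 t, (8 * m.+1 <= t.+1)%N & a (2 * t.+1)%N != 0.
  apply: contrapT => no_t; apply: a_even.
  apply: (@sub_finite_set _ _ `I_(2 * (8 * m.+1))); last exact: finite_II.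
  move=> j [jodd aj] /=; rewrite ltnNge; apply/negP => mj; apply: no_t.
  have j2 : j = (2 * (j./2.-1).+1)%N by lia.
  by exists j./2.-1; [lia | rewrite -j2].
have t0 : (0 < t)%N by lia.
have [r E_neq] := exists_small_scale f_taylor at0.
set sc : R := r.+1%:R^-1 in E_neq.
pose E b := spectral_sum f (sc *: (1%:M + cyc_mx t (sgb R b))).
pose gap := `|E false - E true|.
have gap0 : 0 < gap by rewrite normr_gt0 subr_eq0 /E /sgb expr0 expr1.
pose B := `|E false| + `|E true| + `|f sc| + 1.
have B0 : 0 < B by rewrite ltr_wpDl // !addr_ge0.
pose T : R := t.+1%:R.
have T0 : 0 < T by rewrite ltr0n.
(* The hard values are at most N B <= 4 T l B in modulus, so the tolerance is at most l gap / 4,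
   while the two values are l gap apart. *)
exists (gap / (16 * T * B)); first by rewrite divr_gt0 ?mulr_gt0.
set c := gap / _; move=> k eps k0 /andP[eps0 eps2].
(* With this [delta] the success bound reads 2(1 - eps) <= 3/2 - eps, which fails for eps < 1/2. *)
have delta0 : 0 < 1 / 2 - eps by rewrite subr_gt0.
have [N1 small] := hybrid_gap_small m_gt0 mt delta0.
exists 1 => //; exists (N1 + r.+1 + 4 * t.+1)%N => N S d Omega P A NN A_approx.
rewrite mul1r leNgt; apply/negP => SN.
have [N1N rN tN] : [/\ N1 <= N, r.+1 <= N & 4 * t.+1 <= N]%N.
  by move: NN; clear => NN; split; lia.
have cM : #|{: S.-tuple bool}| = (2 ^ S)%N by rewrite card_tuple card_bool.
have [lam [eta [lam0 lam2 eta0 gap_small]]] := small _ _ _ _ cM N1N erefl SN.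
move: gap_small; set l := (N %/ (2 * t.+1))%N => gap_small.
have lN : (l * (2 * t.+1) <= N)%N by exact: leq_trunc_div.
have Nl : (N <= l * (4 * t.+1))%N.
  have := @ltn_ceil N (2 * t.+1) (ltn0Sn _); rewrite -/l => h1.
  have : (2 <= l)%N by rewrite leq_divRL // mulnA.
  by move: h1; clear; nia.
have N0 : (0 < N)%N by exact: leq_trans rN.
clearbody l; clear small SN NN N1N cM tN.
have [q Nq] : exists q, N = (l * t.+1 + q)%N.
  by exists (N - l * t.+1)%N; rewrite subnKC //; move: lN; clear; nia.
subst N.
have lq : (l * t.+1 <= q)%N by move: lN; clear; nia.
have separated v : approximation c (hard_value f t sc l q false) v ->
    approximation c (hard_value f t sc l q true) v -> False.
  move=> hf ht.
  have Fb b : `|hard_value f t sc l q b| <= (l * t.+1 + q)%:R * B.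
    rewrite /hard_value -/(E b); apply: le_trans (ler_normD _ _) _.
    rewrite !normrM !normr_nat natrD mulrDl lerD //.
      apply: ler_pM => //; first by rewrite ler_nat leq_pmulr.
      by rewrite /B; clear; case: b; have := normr_ge0 (E true);
        have := normr_ge0 (E false); have := normr_ge0 (f sc); lra.
    rewrite ler_wpM2l //; have := normr_ge0 (E true).
    by rewrite /B; have := normr_ge0 (E false); lra.
  have diff : `|hard_value f t sc l q false - hard_value f t sc l q true| =
      l%:R * gap.
    rewrite /hard_value -/(E false) -/(E true) opprD addrACA subrr addr0.
    by rewrite -mulrBr normrM normr_nat.
  have l0 : 0 < l%:R :> R by rewrite ltr0n; move: N0 Nl; clear; case: l => //; lia.
  have c0 : 0 < c by rewrite divr_gt0 ?mulr_gt0.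
  have bound b : approximation c (hard_value f t sc l q b) v ->
      `|v - hard_value f t sc l q b| <= l%:R * gap / 4.
    move=> h; apply: le_trans h _.
    apply: le_trans (ler_wpM2l (ltW c0) (Fb b)) _.
    have NlR : (l * t.+1 + q)%:R <= l%:R * (4 * T).
      by rewrite /T -!natrM ler_nat.
    have cB : 0 <= c * B by rewrite mulr_ge0 // ltW.
    rewrite mulrCA; apply: le_trans (ler_wpM2r cB NlR) _.
    rewrite le_eqVlt; apply/orP; left; apply/eqP; rewrite /c; field.
    by rewrite !gt_eqF.
  have hf' := bound _ hf; have ht' := bound _ ht.
  have lg0 : 0 < l%:R * gap by rewrite mulr_gt0.
  have : l%:R * gap <= l%:R * gap / 4 + l%:R * gap / 4.
    rewrite -[leLHS]diff; set u := hard_value _ _ _ _ _ false in hf' *.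
    set z := hard_value _ _ _ _ _ true in ht' *.
    have -> : u - z = (v - z) - (v - u) by ring.
    apply: le_trans (ler_normB _ _) _.
    exact: lerD.
  by lra.
have := streaming_success_bound t0 lq k0 rN lam0 lam2 eta0 separated A_approx.
by lra.
Qed.
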